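(* Let $K$ be an algebraically closed $p$-adic field, let $m\geq 1$, and let $f(x)=x+ax^{m+1}+\cdots$ and $g(x)=x+ax^{m+1}+\cdots$ be analytic functions over $K$ with the same coefficient $a\neq 0$ (omitted terms of degree $>m+1$). Then there are a closed disk $\overline{D}(0,r)$, $r>0$, invariant under $f$ and $g$, and a lipeomorphism $h:\overline{D}(0,r)\to\overline{D}(0,r)$ with $h(0)=0$ and $h^{-1}\circ f\circ h=g$ on $\overline{D}(0,r)$, such that $h$ extends to a homeomorphism of the closed Berkovich disk $\overline{D}^{\mathcal{B}}(0,r)\to\overline{D}^{\mathcal{B}}(0,r)$.
   Context: A $p$-adic field is a complete non-archimedean valued field $(K,|\cdot|)$ of characteristic zero with $|p|<1$, normalized so that $|p|=1/p$. Analytic means given by a power series with positive radius of convergence at $0$. $\overline D(a,r)=\{x\in K: |x-a|\le r\}$. A homeomorphism is a lipeomorphism if it and its inverse are Lipschitz. The closed Berkovich disk $\overline{D}^{\mathcal{B}}(a,r)$ is the usual compact path-connected space containing $\overline{D}(a,r)$ as a dense subset (with its Gel'fand topology): its points are those of $\overline D(a,r)$ (Type I), points corresponding to closed disks $\overline D(b,s)\subseteq\overline D(a,r)$ (Types II and III), and points corresponding to (equivalence classes of) decreasing chains of closed disks with empty intersection (Type IV). A basis of the topology is given by the finite intersections of open Berkovich disks and complements of closed Berkovich disks. *)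

(* Defs.v *)
From HB Require Import structures.
From mathcomp Require Import all_boot all_order all_algebra.
From mathcomp Require Import all_classical all_reals all_analysis.
Set Implicit Arguments.
Unset Strict Implicit.
Unset Printing Implicit Defensive.
Import Order.TTheory GRing.Theory Num.Theory.
Import numFieldNormedType.Exports.
Local Open Scope classical_set_scope.
Local Open Scope ring_scope.

Definition nonarch_abs (R : realType) (K : fieldType) (v : K -> R) : Prop :=
  [/\ forall x, 0 <= v x,
      forall x, v x = 0 <-> x = 0,
      forall x y, v (x * y) = v x * v y
    & forall x y, v (x + y) <= Num.max (v x) (v y)].

Definition vconverges (R : realType) (K : fieldType) (v : K -> R)
    (u : nat -> K) (l : K) : Prop :=
  (fun n => v (u n - l)) @ \oo --> (0 : R).

Definition vcauchy (R : realType) (K : fieldType) (v : K -> R)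
    (u : nat -> K) : Prop :=
  forall e : R, 0 < e ->
    exists N : nat, forall i j : nat,
      (N <= i)%N -> (N <= j)%N -> v (u i - u j) < e.

Definition vcomplete (R : realType) (K : fieldType) (v : K -> R) : Prop :=
  forall u : nat -> K, vcauchy v u -> exists l : K, vconverges v u l.

Definition padic_field (R : realType) (K : fieldType) (p : nat) (v : K -> R)
    : Prop :=
  [/\ nonarch_abs v, vcomplete v, [pchar K] =i pred0
    & v p%:R = (p%:R)^-1].

Definition closed_disk (R : realType) (K : fieldType) (v : K -> R)
    (a : K) (r : R) : set K :=
  [set x | v (x - a) <= r].

(* f agrees with the convergent power series \sum_k c_k x^k on the open disk
   of radius rho about 0; nothing is said about f elsewhere. *)
Definition power_series_on (R : realType) (K : fieldType) (v : K -> R)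
    (f : K -> K) (c : nat -> K) (rho : R) : Prop :=
  forall x : K, v x < rho ->
    vconverges v (fun n => \sum_(k < n) c k * x ^+ k) (f x).

(* c is the coefficient sequence of x + a x^(m+1) + (terms of degree > m+1). *)
Definition tangent_to_id (K : fieldType) (m : nat) (a : K) (c : nat -> K)
    : Prop :=
  [/\ c 0%N = 0, c 1%N = 1,
      forall k : nat, (1 < k <= m)%N -> c k = 0
    & c m.+1 = a].

Definition lipschitz_on_set (R : realType) (K : fieldType) (v : K -> R)
    (A : set K) (h : K -> K) : Prop :=
  exists L : R, forall x y : K, A x -> A y -> v (h x - h y) <= L * v (x - y).

Definition mutually_inverse (T U : Type) (A : set T) (B : set U)
    (h : T -> U) (h' : U -> T) : Prop :=
  [/\ set_fun A B h, set_fun B A h',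
      forall x, A x -> h' (h x) = x
    & forall y, B y -> h (h' y) = y].

(* A lipeomorphism A -> A with its inverse h'; continuity in both directions
   follows from the Lipschitz bounds. *)
Definition lipeomorphism (R : realType) (K : fieldType) (v : K -> R)
    (A : set K) (h h' : K -> K) : Prop :=
  [/\ mutually_inverse A A h h',
      lipschitz_on_set v A h
    & lipschitz_on_set v A h'].

Definition homeomorphism (T U : topologicalType) (A : set T) (B : set U)
    (h : T -> U) : Prop :=
  exists h' : U -> T,
    [/\ mutually_inverse A B h h',
        {within A, continuous h}
      & {within B, continuous h'}].

(* The points are the multiplicative seminorms on K[T] extending v with
   |T - a| <= r, i.e. the bounded multiplicative seminorms on the Tate algebra
   of the disk D(a, r), restricted to the dense subring K[T].  The Gel'fand
   topology is the one induced by pointwise convergence on K[T], carried by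
   the ambient type. *)
Definition berkovich_disk (R : realType) (K : fieldType) (v : K -> R)
    (a : K) (r : R) : set {ptws {poly K} -> R} :=
  [set N : {ptws {poly K} -> R} |
    [/\ (forall P, 0 <= N P) /\ (forall P Q, N (P + Q) <= N P + N Q),
        forall P Q, N (P * Q) = N P * N Q,
        forall c : K, N c%:P = v c
      & N ('X - a%:P) <= r]].

(* Type I points: evaluation at a point of K. *)
Definition typeI (R : realType) (K : fieldType) (v : K -> R) (x : K)
    : {ptws {poly K} -> R} :=
  fun P => v P.[x].

Lemma typeI_berkovich_disk (R : realType) (K : fieldType) (v : K -> R)
    (a : K) (r : R) (x : K) :
  nonarch_abs v -> closed_disk v a r x -> berkovich_disk v a r (typeI v x).
Proof.
move=> [v0 _ vM vD] xr; rewrite /berkovich_disk /typeI /=; split.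
- split=> [P|P Q]; first exact: v0.
  rewrite hornerD (le_trans (vD _ _))// ge_max.
  by rewrite lerDl v0 lerDr v0.
- by move=> P Q; rewrite hornerM vM.
- by move=> c; rewrite hornerC.
- by rewrite hornerXsubC.
Qed.

(* Main.v *)
(* Every isometric bijection of the disk extends to the Berkovich disk, so it
   suffices to conjugate [f] to [g] by an isometry.

   Put [t = a x0 ^ (m+1)]. Near [x0 <> 0] and in the coordinate [(x - x0) / t],
   both maps are [z |-> z + 1] on the unit disk up to a perturbation that is
   tiny together with its first and second differences. For such a map [F],
   [|F^n z - z - n|] is small compared with [|n|_p], so [n |-> F^n z] extends to
   [Z_p]. Let [pi] be a Lipschitz map from the unit disk to [Z_p] that commutes
   with integer translations; then [h x = F^(pi x) (x - pi x)] satisfies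
   [h (x + 1) = F (h x)] and is the identity plus a contraction, hence an
   isometric bijection. Composing the two straightenings conjugates [f] to [g]
   on each disk [D(x0, |t|)]. These disks partition the punctured disk and the
   conjugacies preserve each of them, so they glue to an isometry.

   A point [N] of the Berkovich disk is determined by its values on linear
   polynomials; the extension of [h] sends it to the multiplicative function
   with value [N (X - h^-1 b)] at [X - b]. Subadditivity follows because
   finitely many values of [N] on linear factors are approximated from below by
   a type I point, the value group of [K] being dense. *)
Require Import Defs.
From mathcomp Require Import all_boot all_order all_algebra.
From mathcomp Require Import all_classical all_reals all_analysis.
From mathcomp Require Import ring lra zify.
Import Order.TTheory GRing.Theory Num.Theory.
Import numFieldNormedType.Exports.
Local Open Scope classical_set_scope.
Local Open Scope ring_scope.
Set Implicit Arguments.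
Unset Strict Implicit.
Unset Printing Implicit Defensive.

(** * Nonarchimedean absolute values *)

Section NonarchimedeanAbs.
Context (R : realType) (K : fieldType) (v : K -> R).
Hypothesis vna : nonarch_abs v.

Lemma vabs_ge0 x : 0 <= v x.
Proof. by case: vna. Qed.

Lemma vabs_eq0 x : (v x == 0) = (x == 0).
Proof. by case: vna => _ v0 _ _; apply/eqP/eqP => /v0. Qed.

Lemma vabs0 : v 0 = 0.
Proof. by apply/eqP; rewrite vabs_eq0. Qed.

Lemma vabs_gt0 x : (0 < v x) = (x != 0).
Proof. by rewrite lt_def vabs_ge0 andbT vabs_eq0. Qed.

Lemma vabsM x y : v (x * y) = v x * v y.
Proof. by case: vna. Qed.

Lemma vabs1 : v 1 = 1.
Proof.
have v1 : v 1 != 0 by rewrite vabs_eq0 oner_neq0.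
by apply: (mulfI v1); rewrite -vabsM !mulr1.
Qed.

Lemma vabsX x n : v (x ^+ n) = v x ^+ n.
Proof. by elim: n => [|n IH]; rewrite ?expr0 ?vabs1// !exprS vabsM IH. Qed.

Lemma vabsV x : v x^-1 = (v x)^-1.
Proof.
have [->|x0] := eqVneq x 0; first by rewrite invr0 vabs0 invr0.
have vx0 : v x != 0 by rewrite vabs_eq0.
by apply: (mulfI vx0); rewrite -vabsM !mulfV ?vabs1.
Qed.

Lemma vabsN x : v (- x) = v x.
Proof.
suff vN1 : v (- 1) = 1 by rewrite -mulN1r vabsM vN1 mul1r.
apply: (@pexpIrn _ 2) => //; rewrite ?nnegrE ?vabs_ge0//.
by rewrite -vabsX sqrrN expr1n vabs1 expr1n.
Qed.

Lemma vabs_distC x y : v (x - y) = v (y - x).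
Proof. by rewrite -vabsN opprB. Qed.

Lemma vabs_leD c x y : v x <= c -> v y <= c -> v (x + y) <= c.
Proof.
by case: vna => _ _ _ vD xc yc; rewrite (le_trans (vD x y))// ge_max xc yc.
Qed.

Lemma vabs_leB c x y : v x <= c -> v y <= c -> v (x - y) <= c.
Proof. by move=> xc yc; apply: vabs_leD => //; rewrite vabsN. Qed.

Lemma vabs_le_trans c x y z : v (x - y) <= c -> v (y - z) <= c ->
  v (x - z) <= c.
Proof. by move=> xy yz; rewrite -(subrKA y x); apply: vabs_leD. Qed.

Lemma vabs_sum_le c I (r : seq I) (P : pred I) (F : I -> K) : 0 <= c ->
  (forall i, P i -> v (F i) <= c) -> v (\sum_(i <- r | P i) F i) <= c.
Proof.
move=> c0 Fc; elim/big_ind: _ => //; first by rewrite vabs0.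
exact: vabs_leD.
Qed.

Lemma vabs_nat_le1 n : v n%:R <= 1.
Proof.
by elim: n => [|n IH]; rewrite ?vabs0 ?ler01// -natr1 vabs_leD ?vabs1.
Qed.

Lemma vabsD_dominant x y : v y < v x -> v (x + y) = v x.
Proof.
case: vna => _ _ _ vD yx; apply/eqP; rewrite eq_le; apply/andP; split.
  by apply: vabs_leD => //; exact: ltW.
have := vD (x + y) (- y); rewrite addrK vabsN le_max => /orP[//|xy].
by have := lt_le_trans yx xy; rewrite ltxx.
Qed.

Lemma vabs_le_near x y c : v (x - y) <= c -> v x <= c -> v y <= c.
Proof. by move=> xy xc; rewrite -[y](subKr x); apply: vabs_leB. Qed.

Lemma vabs_prod I (r : seq I) (F : I -> K) :
  v (\prod_(i <- r) F i) = \prod_(i <- r) v (F i).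
Proof.
elim: r => [|i r IH]; first by rewrite !big_nil vabs1.
by rewrite !big_cons vabsM IH.
Qed.

Lemma vconvergesP (u : nat -> K) l : vconverges v u l ->
  forall e : R, 0 < e -> exists N, forall n, (N <= n)%N -> v (u n - l) < e.
Proof.
move=> /cvgrPdist_lt ul e e0; have [N _ Nu] := ul e e0.
exists N => n Nn; have := Nu n Nn.
by rewrite sub0r normrN ger0_norm ?vabs_ge0.
Qed.

Lemma vconvergesE (u : nat -> K) l :
  (forall e : R, 0 < e -> exists N, forall n, (N <= n)%N -> v (u n - l) <= e) ->
  vconverges v u l.
Proof.
move=> ul; apply/cvgrPdist_le => e e0; have [N Nu] := ul e e0.
by exists N => // n /Nu; rewrite sub0r normrN ger0_norm ?vabs_ge0.
Qed.

Lemma vabs_lim_le c (u : nat -> K) l : vconverges v u l ->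
  (forall n, v (u n) <= c) -> v l <= c.
Proof.
move=> ul uc; apply/ler_addgt0Pr => e e0.
have [N Nu] := vconvergesP ul e0.
have := Nu _ (leqnn N) => uNl.
have c0 : 0 <= c by apply: le_trans (uc 0%N); exact: vabs_ge0.
apply: (@vabs_le_near (u N)).
  by rewrite (le_trans (ltW uNl))// lerDr.
by rewrite (le_trans (uc N))// lerDl ltW.
Qed.

Lemma vconvergesB (s t : nat -> K) l l' : vconverges v s l ->
  vconverges v t l' ->
  vconverges v (fun n => s n - t n) (l - l').
Proof.
move=> sl tl; apply: vconvergesE => e e0.
have [N Nu] := vconvergesP sl e0; have [N' Nu'] := vconvergesP tl e0.
exists (maxn N N') => n; rewrite geq_max => /andP[Nn Nn'].
have -> : s n - t n - (l - l') = (s n - l) - (t n - l').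
  by ring.
by apply: vabs_leB; apply: ltW; [exact: Nu|exact: Nu'].
Qed.

End NonarchimedeanAbs.

Lemma natr_ltn_expr (R : realType) (b : R) (n : nat) : 2 <= b -> n%:R < b ^+ n.
Proof.
move=> b2; apply: (@lt_le_trans _ _ (2 ^+ n)); last first.
  by apply: lerXn2r => //; rewrite nnegrE ?ler0n// (le_trans _ b2).
by rewrite -natrX ltr_nat ltn_expl.
Qed.

(** Since [q^-1 >= 2], the powers of [q^-1] exceed every natural number, so a positive [x] would
    break the bound. This is the form in which the decay of [q ^+ k] serves arguments at precision
    [q ^+ k]. *)
Lemma le0_geometric (R : realType) (q C x : R) : 0 < q <= 2^-1 ->
  (forall k : nat, x <= C * q ^+ k) -> x <= 0.
Proof.
move=> /andP[q0 q2] xC; rewrite leNgt; apply/negP => x0.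
have C0 : 0 < C by have := xC 0%N; rewrite expr0 mulr1; apply: lt_le_trans.
have b2 : 2 <= q^-1.
  by rewrite -[2]invrK lef_pV2 ?posrE ?invr_gt0.
have [n Cx] : exists n : nat, C / x < n%:R.
  by exists (Num.bound (C / x)); rewrite archi_boundP// divr_ge0 ?ltW.
have := lt_trans Cx (natr_ltn_expr n b2).
rewrite ltr_pdivrMr// exprVn mulrC ltr_pdivlMr ?exprn_gt0//.
by rewrite ltNge xC.
Qed.

Section Limits.
Context (R : realType) (K : fieldType) (v : K -> R).
Hypothesis (vna : nonarch_abs v) (vc : vcomplete v).

(** By the ultrametric inequality a sum of increments is no larger than the bound on the first one,
    so the error at stage [k] carries no factor from summing a geometric series. *)
Lemma geometric_limit (q C : R) (u : nat -> K) : 0 < q <= 2^-1 -> 0 <= C ->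
  (forall k, v (u k.+1 - u k) <= C * q ^+ k) ->
  exists l, forall k, v (u k - l) <= C * q ^+ k.
Proof.
move=> q12 C0 uC; have /andP[q0 q2] := q12.
have {}q0 := ltW q0; have q1 : q <= 1
  by rewrite (le_trans q2)// invf_le1// ler1n.
have qS k j : C * q ^+ (k + j) <= C * q ^+ k.
  by rewrite ler_wpM2l// exprD ler_piMr ?exprn_ile1 ?exprn_ge0.
have ukj k j : v (u (k + j)%N - u k) <= C * q ^+ k.
  elim: j => [|j IH].
    by rewrite addn0 subrr (vabs0 vna) mulr_ge0// exprn_ge0.
  apply: (vabs_le_trans vna) IH; rewrite addnS.
  exact: le_trans (uC _) (qS _ _).
have [l ul] : exists l, vconverges v u l.
  apply: vc => e e0.
  have [N CN] : exists N : nat, C * q ^+ N < e.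
    apply: contrapT => nN.
    have := @le0_geometric _ q C e q12.
    suff h : forall k : nat, e <= C * q ^+ k.
      by move=> /(_ h); rewrite leNgt e0.
    by move=> k; rewrite leNgt; apply/negP => h; apply: nN; exists k.
  exists N => i j Ni Nj; apply: le_lt_trans CN.
  rewrite -(subnKC Ni) -(subnKC Nj).
  apply: (vabs_le_trans vna) (ukj _ _) _; rewrite vabs_distC//.
exists l => k; apply: (@vabs_lim_le _ _ _ vna _ (fun n => u k - u (k + n)%N)).
  apply: vconvergesE => // e e0; have [N Nu] := vconvergesP vna ul e0.
  exists N => n Nn; have ->
    : u k - u (k + n)%N - (u k - l) = - (u (k + n)%N - l) by ring.
  by rewrite vabsN//; apply/ltW/Nu; rewrite (leq_trans Nn)// leq_addl.
by move=> n; rewrite vabs_distC.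
Qed.

End Limits.

(** * Iterates of perturbed translations *)

(** The second difference in the last bound stands in for a second derivative. Under iteration [M]
    controls how [L] shrinks, and [L] in turn how [A] shrinks. *)
Definition nearly_translation (R : realType) (K : fieldType) (v : K -> R)
    (t : K) (A L M : R) (F : K -> K) : Prop :=
  [/\ forall z, v z <= 1 -> v (F z - z - t) <= A,
      forall z z', v z <= 1 -> v z' <= 1 ->
        v (F z - F z' - (z - z')) <= L * v (z - z')
    & forall z z' u, v z <= 1 -> v z' <= 1 -> v u <= 1 ->
        v (F (z + u) - F z - F (z' + u) + F z') <= M * (v (z - z') * v u)].

Section NearlyTranslation.
Context (R : realType) (K : fieldType) (v : K -> R).
Hypothesis vna : nonarch_abs v.

Section Fixed.
Context (A L M : R) (t : K) (F : K -> K).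
Hypotheses (A1 : A <= 1) (L0 : 0 <= L) (L1 : L <= 1) (t1 : v t <= 1).
Hypothesis ntF : nearly_translation v t A L M F.

Lemma nearly_translation_disk z : v z <= 1 -> v (F z) <= 1.
Proof.
case: ntF => FA _ _ z1.
have -> : F z = (F z - z - t) + (z + t) by ring.
by apply: vabs_leD => //; [exact: le_trans (FA _ z1) A1|exact: vabs_leD].
Qed.

Lemma nearly_translation_nonexpansive z z' : v z <= 1 -> v z' <= 1 ->
  v (F z - F z') <= v (z - z').
Proof.
case: ntF => _ FL _ z1 z'1.
have -> : F z - F z' = (F z - F z' - (z - z')) + (z - z') by ring.
rewrite vabs_leD// (le_trans (FL _ _ z1 z'1))//.
by rewrite ler_piMl// vabs_ge0.
Qed.

End Fixed.

Lemma nearly_translation_id A L M : 0 <= A -> 0 <= L -> 0 <= M ->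
  nearly_translation v 0 A L M id.
Proof.
move=> A0 L0 M0; split=> *.
- by rewrite subr0 subrr (vabs0 vna).
- by rewrite subrr (vabs0 vna) mulr_ge0 ?vabs_ge0.
- by rewrite [X in v X](_ : _ = 0);
  [rewrite (vabs0 vna) !mulr_ge0 ?vabs_ge0|ring].
Qed.

(** Ultrametric sums are bounded by their largest term, so translations add while the three
    constants do not grow. *)
Lemma nearly_translation_comp A L M s t F G :
  A <= 1 -> 0 <= L -> L <= 1 -> 0 <= M -> v s <= 1 -> v t <= 1 ->
  nearly_translation v t A L M F -> nearly_translation v s A L M G ->
  nearly_translation v (t + s) A L M (F \o G).
Proof.
move=> A1 L0 L1 M0 s1 t1 ntF ntG.
have GO z : v z <= 1 -> v (G z) <= 1 by apply: nearly_translation_disk ntG _.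
have Gn z z' : v z <= 1 -> v z' <= 1 -> v (G z - G z') <= v (z - z').
  exact: nearly_translation_nonexpansive ntG _ _.
have Fn z z' : v z <= 1 -> v z' <= 1 -> v (F z - F z') <= v (z - z').
  exact: nearly_translation_nonexpansive ntF _ _.
have [FA FL FM] := ntF; have [GA GL GM] := ntG.
split=> [z z1|z z' z1 z'1|z z' u z1 z'1 u1] /=.
- have -> : F (G z) - z - (t + s) = (F (G z) - G z - t) + (G z - z - s) by ring.
  by rewrite vabs_leD ?FA ?GA ?GO.
- have -> : F (G z) - F (G z') - (z - z') =
    (F (G z) - F (G z') - (G z - G z')) + (G z - G z' - (z - z')) by ring.
  rewrite vabs_leD ?GL// (le_trans (FL _ _ _ _)) ?GO//.
  by rewrite ler_wpM2l ?Gn.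
- have zu1 : v (z + u) <= 1 by rewrite vabs_leD.
  have zu'1 : v (z' + u) <= 1 by rewrite vabs_leD.
  (* With [U = G (z + u) - G z], this is a second difference of [F] for the increment [U], plus the
     difference of [F] at two points that differ by the second difference of [G]. *)
  have -> : F (G (z + u)) - F (G z) - F (G (z' + u)) + F (G z') =
    (F (G z + (G (z + u) - G z)) - F (G z)
     - F (G z' + (G (z + u) - G z)) + F (G z')) +
    (F (G z' + (G (z + u) - G z)) - F (G (z' + u))).
    by rewrite (subrKC (G z)); ring.
  have U1 : v (G (z + u) - G z) <= 1 by rewrite vabs_leB ?GO.
  apply: vabs_leD => //.
    rewrite (le_trans (FM _ _ _ _ _ _)) ?GO// ler_wpM2l//.
    rewrite ler_pM ?vabs_ge0 ?Gn// (le_trans (Gn _ _ _ _))//.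
    by rewrite addrC addKr.
  have U'1 : v (G z' + (G (z + u) - G z)) <= 1 by apply: vabs_leD => //;
    exact: GO.
  rewrite (le_trans (Fn _ _ U'1 (GO _ zu'1)))//.
  rewrite (le_trans _ (GM _ _ _ z1 z'1 u1))//.
  by rewrite [X in v X <= _](_ : _ = G (z + u) - G z - G (z' + u) + G z')//;
    ring.
Qed.

Lemma nearly_translation_iter A L M t F n :
  0 <= A -> A <= 1 -> 0 <= L -> L <= 1 -> 0 <= M -> v t <= 1 ->
  nearly_translation v t A L M F ->
  nearly_translation v (n%:R * t) A L M (iter n F).
Proof.
move=> A0 A1 L0 L1 M0 t1 ntF; elim: n => [|n IH].
  by rewrite mul0r; exact: nearly_translation_id.
rewrite -natr1 mulrDl mul1r addrC.
apply: nearly_translation_comp => //; rewrite vabsM//.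
by rewrite mulr_ile1 ?vabs_ge0 ?vabs_nat_le1.
Qed.

(* Averaging over [p] iterates gains a factor [|p|] in the first two bounds:
   iterating [n] times multiplies the displacement by [n], up to an error
   controlled by one more difference. *)
Lemma nearly_translation_iter_scale A L M A' L' t F p :
  0 <= A -> A <= v t -> 0 <= L -> L <= 1 -> 0 <= M -> v t <= 1 ->
  v p%:R * A <= A' -> L * v t <= A' ->
  v p%:R * L <= L' -> M * v t <= L' -> L * L <= L' ->
  nearly_translation v t A L M F ->
  nearly_translation v (p%:R * t) A' L' M (iter p F).
Proof.
move=> A0 At L0 L1 M0 t1 pA LtA pL MtL LLL ntF.
have A1 := le_trans At t1.
have ntn n := nearly_translation_iter n A0 A1 L0 L1 M0 t1 ntF.
have A'0 : 0 <= A' by rewrite (le_trans _ LtA)// mulr_ge0 ?vabs_ge0.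
have L'0 : 0 <= L' by rewrite (le_trans _ LLL)// mulr_ge0.
have [FA FL FM] := ntF.
have nt1 n : v (n%:R * t) <= v t.
  by rewrite vabsM// ler_piMl ?vabs_ge0 ?vabs_nat_le1.
have FO n z : v z <= 1 -> v (iter n F z) <= 1.
  move=> z1; apply: (nearly_translation_disk _ _ (ntn n)) => //.
  exact: le_trans (nt1 n) t1.
have dist n z : v z <= 1 -> v (iter n F z - z) <= v t.
  move=> z1; have [nA _ _] := ntn n; have h := nA z z1.
  have -> : iter n F z - z = (iter n F z - z - n%:R * t) + n%:R * t by ring.
  by rewrite vabs_leD ?nt1// (le_trans h).
have [_ _ pM] := ntn p.
split=> [z z1|z z' z1 z'1|//].
(* The last term is at most [v p * A]. The rest sums the changes of [F - id] between [z] and its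
   iterates, each at most [L * v t] because the iterates stay within [v t] of [z]. *)
- have -> : iter p F z - z - p%:R * t =
    (iter p F z - z - p%:R * (F z - z)) + p%:R * (F z - z - t) by ring.
  rewrite vabs_leD//; last first.
    by rewrite vabsM// (le_trans _ pA)// ler_wpM2l ?FA ?vabs_ge0.
  elim: (p) => [|n IH] /=; first by rewrite mul0r subr0 subrr (vabs0 vna).
  have -> : F (iter n F z) - z - n.+1%:R * (F z - z) =
    (F (iter n F z) - F z - (iter n F z - z)) + (iter n F z - z - n%:R * (F z -
      z)).
    by rewrite -natr1; ring.
  rewrite vabs_leD// (le_trans (FL _ _ _ _)) ?FO// (le_trans _ LtA)//.
  by rewrite ler_wpM2l ?dist.
- have -> : iter p F z - iter p F z' - (z - z') =
    (iter p F z - iter p F z' - (z - z') - p%:R * (F z - F z' - (z - z'))) +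
    p%:R * (F z - F z' - (z - z')) by ring.
  rewrite vabs_leD//; last first.
    rewrite vabsM// (le_trans (ler_wpM2l _ (FL _ _ z1 z'1))) ?vabs_ge0//.
    by rewrite mulrA ler_wpM2r ?vabs_ge0.
  elim: (p) => [|n IH] /=.
    by rewrite subrr mul0r subr0 (vabs0 vna) mulr_ge0 ?vabs_ge0.
  have [_ nL _] := ntn n.
  set a := iter n F z; set b := iter n F z'.
  (* Shift [z'] by the increment [a - z]: the first group is a second difference of [F], and
     [z' + (a - z)] misses [b] by at most [L * v (z - z')], whence the factor [L * L]. *)
  have -> : F a - F b - (z - z') - n.+1%:R * (F z - F z' - (z - z')) =
    ((F (z + (a - z)) - F z - F (z' + (a - z)) + F z') +
     (F (z' + (a - z)) - F b - (z' + (a - z) - b))) +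
    (a - b - (z - z') - n%:R * (F z - F z' - (z - z'))).
    have -> : z + (a - z) = a by ring.
    rewrite -[n.+1%:R]natr1; ring.
  have az1 : v (a - z) <= 1 by rewrite (le_trans (dist _ _ _)).
  apply: vabs_leD => //; apply: vabs_leD => //.
    rewrite (le_trans (FM _ _ _ z1 z'1 az1))//
      mulrCA mulrC ler_wpM2r ?vabs_ge0//.
    by rewrite (le_trans _ MtL)// ler_wpM2l ?dist.
  have z'az : v (z' + (a - z)) <= 1 by exact: vabs_leD.
  rewrite (le_trans (FL _ _ z'az (FO _ _ z'1)))//.
  apply: (@le_trans _ _ (L * (L * v (z - z')))).
    rewrite ler_wpM2l// (le_trans _ (nL _ _ z1 z'1))//.
    by rewrite -/a -/b [X in v X <= _](_ : _ = a - b - (z - z'))//; ring.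
  by rewrite mulrA ler_wpM2r ?vabs_ge0.
Qed.

End NearlyTranslation.

(** * Iterates compared with the p-adic size of their number *)

Section PadicNat.
Context (R : realType) (K : fieldType) (p : nat) (v : K -> R).
Hypotheses (vna : nonarch_abs v) (pp : prime p) (vp : v p%:R = p%:R^-1).

Lemma vabs_p_half : 0 < v p%:R <= 2^-1.
Proof.
have p2 := prime_gt1 pp.
rewrite vp invr_gt0 ltr0n (ltn_trans _ p2)//= lef_pV2 ?ler_nat// posrE ltr0n//.
exact: ltn_trans p2.
Qed.

Lemma vabs_p_lt1 : v p%:R < 1.
Proof.
by have /andP[_ /le_lt_trans] := vabs_p_half; apply; rewrite invf_lt1// ltr1n.
Qed.

Lemma vabs_coprime_p u : coprime p u -> (0 < u)%N -> v u%:R = 1.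
Proof.
move=> pu u0; apply/eqP; rewrite eq_le vabs_nat_le1//= leNgt; apply/negP => vu.
(* Bezout gives [1 + a p = c u]: the left side has absolute value [1], the right side less than [1]
   if [v u < 1]. *)
have [a _ /dvdnP[c /(congr1 (fun n => v (n%:R : K)))]] := Bezoutl p u0.
rewrite gcdnC (eqP pu) natrD natrM natrM vabsD_dominant// ?vabsM//.
  rewrite (vabs1 vna) => h; suff : v c%:R * v u%:R < 1 by rewrite -h ltxx.
  rewrite (le_lt_trans _ vu)// ler_piMl ?vabs_ge0 ?vabs_nat_le1//.
rewrite (vabs1 vna) (le_lt_trans _ vabs_p_lt1)//
  ler_piMl ?vabs_ge0 ?vabs_nat_le1//.
Qed.

Variable F : K -> K.
Let q := v p%:R.
Hypothesis ntF : nearly_translation v 1 (q ^+ 4) (q ^+ 4) (q ^+ 4) F.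

Let q0 : 0 <= q. Proof. exact: vabs_ge0. Qed.
Let q1 : q <= 1. Proof. exact: vabs_nat_le1. Qed.
Let qle m n : (m <= n)%N -> q ^+ n <= q ^+ m.
Proof. by move=> mn; rewrite ler_wiXn2l. Qed.

(** Each [p]-fold iteration gains a factor [q] in the first two bounds. At level [k] the translation
    has size [q ^+ k], so [L * v t = q ^+ (3 + 2k)] and [M * v t = q ^+ (4 + k)] fit the bounds of
    level [k.+1]; this dictates the exponents [2], [3], [4]. *)
Lemma nearly_translation_iter_pX k :
  nearly_translation v (p%:R ^+ k) (q ^+ (2 + k)) (q ^+ (3 + k)) (q ^+ 4)
    (iter (p ^ k) F).
Proof.
elim: k => [|k IH].
  case: ntF => FA FL FM; rewrite expr0 expn0; split=> //= [z z1|z z' z1 z'1].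
    by rewrite (le_trans (FA _ z1))// qle.
  by rewrite (le_trans (FL _ _ z1 z'1))// ler_wpM2r ?vabs_ge0 ?qle.
rewrite exprS expnS.
have -> : iter (p * p ^ k) F = iter p (iter (p ^ k) F).
  by apply/funext => z; rewrite iterM.
have vX : v (p%:R ^+ k) = q ^+ k by rewrite vabsX.
by apply: nearly_translation_iter_scale IH => //;
  rewrite ?vX -?exprD -?exprS ?exprn_ge0 ?exprn_ile1//;
  apply: qle; rewrite ?addnS ?addSn ?addnn ?leqnn// -?addnn; lia.
Qed.

(** Write [d = u p ^ k] with [u] prime to [p], so that [v d = q ^+ k]. Iterating the [p ^ k]-th
    iterate [u] times leaves its error [q ^+ (2 + k)] unchanged. *)
Lemma iter_nat_displacement d z : v z <= 1 ->
  v (iter d F z - z - d%:R) <= q ^+ 2 * v d%:R.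
Proof.
move=> z1; have [->|d0] := posnP d.
  by rewrite subrr sub0r (vabsN vna) (vabs0 vna) mulr0.
have [u pu du] := pfactor_coprime pp d0.
have u0 : (0 < u)%N by move: d0; rewrite du; case: (u).
set k := logn p d in du.
have vd : v d%:R = q ^+ k.
  by rewrite du natrM vabsM// vabs_coprime_p// mul1r natrX vabsX.
have vX : v (p%:R ^+ k) <= 1 by rewrite vabsX// exprn_ile1.
have [dA _ _] := nearly_translation_iter vna u (exprn_ge0 _ q0)
  (exprn_ile1 _ q0 q1) (exprn_ge0 _ q0) (exprn_ile1 _ q0 q1) (exprn_ge0 _ q0) vX
  (nearly_translation_iter_pX k).
by rewrite vd -exprD (le_trans _ (dA z z1))// {1 2}du iterM natrM natrX.
Qed.

End PadicNat.

(** * Straightening a perturbed translation *)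

Section PadicPart.
Context (R : realType) (K : fieldType) (p : nat) (v : K -> R).
Hypotheses (vna : nonarch_abs v) (pp : prime p) (vp : v p%:R = p%:R^-1).
Let q := v p%:R.
Let q0 : 0 <= q. Proof. exact: vabs_ge0. Qed.
Let q1 : q <= 1. Proof. exact: vabs_nat_le1. Qed.

Definition nat_close k : rel K := fun x y =>
  `[< exists n : nat, v (x - y - n%:R) <= q ^+ k >].

Lemma nat_close_refl k x : nat_close k x x.
Proof. by apply/asboolP; exists 0%N; rewrite subrr subr0 (vabs0 vna) exprn_ge0.
Qed.

(** Shifts are natural numbers, so [- n] is replaced by [n (p ^ k - 1)], congruent to it modulo
    [p ^ k]. *)
Lemma nat_close_sym k x y : nat_close k x y -> nat_close k y x.
Proof.
move=> /asboolP[n xyn]; apply/asboolP; exists (n * (p ^ k - 1))%N.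
have pk : (0 < p ^ k)%N by rewrite expn_gt0 prime_gt0.
rewrite natrM natrB// natrX.
have -> : y - x - n%:R * (p%:R ^+ k - 1) =
  - (x - y - n%:R) - n%:R * p%:R ^+ k by ring.
rewrite vabs_leB ?vabsN// vabsM// vabsX// ler_piMl ?exprn_ge0//.
exact: vabs_nat_le1.
Qed.

Lemma nat_close_trans k x y z : nat_close k x y -> nat_close k y z ->
  nat_close k x z.
Proof.
move=> /asboolP[n xyn] /asboolP[n' yzn]; apply/asboolP; exists (n + n')%N.
have -> : x - z - (n + n')%:R = (x - y - n%:R) + (y - z - n'%:R).
  by rewrite natrD; ring.
exact: vabs_leD.
Qed.

(** Chosen from the class as a set, so that all its points get the same representative. *)
Definition nat_repr k x : K := xget 0 [set y | nat_close k x y].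

Lemma nat_reprP k x : nat_close k x (nat_repr k x).
Proof. by rewrite /nat_repr; case: xgetP => // /(_ x) [];
  exact: nat_close_refl. Qed.

Lemma nat_repr_eq k x y : nat_close k x y -> nat_repr k x = nat_repr k y.
Proof.
move=> xy; rewrite /nat_repr; congr xget; apply/seteqP; split=> z /=.
  exact/nat_close_trans/nat_close_sym.
exact: nat_close_trans.
Qed.

Definition nat_offset k x : nat :=
  xget 0%N [set n | v (x - nat_repr k x - n%:R) <= q ^+ k].

Lemma nat_offsetP k x : v (x - nat_repr k x - (nat_offset k x)%:R) <= q ^+ k.
Proof.
rewrite /nat_offset; case: xgetP => // no.
by have /asboolP[n] := nat_reprP k x; move=> /no.
Qed.

(* [padic_part k] is the approximation modulo [p ^ k] of a map [K -> Z_p] which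
   commutes with integer translations and is Lipschitz; refining it from level
   [k] to [k.+1] only requires a choice on one representative of each class. *)
Fixpoint padic_part k (x : K) : nat :=
  if k is k'.+1 then (nat_offset k x + padic_part k' (nat_repr k x))%N else 0.

(** At a positive level [x] and [y] share a representative [c], so the lower-level parts cancel and
    the offsets approximate [x - c] and [y - c]. The case [n = 0] is the Lipschitz property, [n = 1]
    the commutation with translation by [1]. *)
Lemma padic_part_translate k x y n : v (x - y - n%:R) <= q ^+ k ->
  v ((padic_part k x)%:R - (padic_part k y)%:R - n%:R) <= q ^+ k.
Proof.
case: k => [|k] xy /=.
  by rewrite subrr sub0r vabsN// vabs_nat_le1.
have xyc : nat_close k.+1 x y by apply/asboolP; exists n.
have xo := nat_offsetP k.+1 x; have yo := nat_offsetP k.+1 y.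
rewrite -(nat_repr_eq xyc) in yo *; rewrite !natrD.
have -> : forall a b c : K, a + c - (b + c) - n%:R = a - b - n%:R by move=> *;
  ring.
set a := (nat_offset k.+1 x)%:R in xo *;
  set b := (nat_offset k.+1 y)%:R in yo *.
set c := nat_repr k.+1 x in xo yo.
have -> : a - b - n%:R = (x - y - n%:R) - (x - c - a) + (y - c - b) by ring.
by apply: vabs_leD => //; apply: vabs_leB.
Qed.

(** Up to [q ^+ k], [x] is its representative of level [k.+1] translated by the offset, so the
    translation property at level [k] applies. *)
Lemma padic_part_succ k x : v ((padic_part k.+1 x)%:R - (padic_part k x)%:R) <=
  q ^+ k.
Proof.
have xo : v (x - nat_repr k.+1 x - (nat_offset k.+1 x)%:R) <= q ^+ k.
  by rewrite (le_trans (nat_offsetP _ _))// exprS ler_piMl// exprn_ge0.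
have := padic_part_translate xo; rewrite /= natrD -vabsN//.
by congr (v _ <= _); ring.
Qed.

End PadicPart.

Definition isometric_bijection (R : realType) (K : fieldType) (v : K -> R)
    (A : set K) (h h' : K -> K) : Prop :=
  mutually_inverse A A h h' /\
  forall x y, A x -> A y -> v (h x - h y) = v (x - y).

Lemma isometric_bijection_sym (R : realType) (K : fieldType) (v : K -> R)
    (A : set K) (h h' : K -> K) :
  isometric_bijection v A h h' -> isometric_bijection v A h' h.
Proof.
move=> [[hA h'A h'K hK] hi]; split; first by split.
by move=> x y Ax Ay; rewrite -hi ?hK//; exact: h'A.
Qed.

Lemma isometric_bijection_comp (R : realType) (K : fieldType) (v : K -> R)
    (A : set K) (h h' g g' : K -> K) :
  isometric_bijection v A h h' -> isometric_bijection v A g g' ->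
  isometric_bijection v A (h \o g) (g' \o h').
Proof.
move=> [[hA h'A h'K hK] hi] [[gA g'A g'K gK] gi]; split; last first.
  by move=> x y Ax Ay /=; rewrite hi ?gi//; exact: gA.
split=> [x /gA/hA //|x /h'A/g'A //|x Ax|x Ax] /=.
  by rewrite h'K ?g'K//; exact: gA.
by rewrite gK ?hK//; exact: h'A.
Qed.

Section Straightening.
Context (R : realType) (K : fieldType) (p : nat) (v : K -> R).
Hypotheses (vna : nonarch_abs v) (vc : vcomplete v) (pp : prime p).
Hypothesis (vp : v p%:R = p%:R^-1).
Let q := v p%:R.
Let q12 : 0 < q <= 2^-1. Proof. exact: vabs_p_half. Qed.
Let q0 : 0 <= q. Proof. exact: vabs_ge0. Qed.
Let q1 : q <= 1. Proof. exact: vabs_nat_le1. Qed.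

Lemma eq_of_vabs_le (x y : K) : (forall k, v (x - y) <= q ^+ k) -> x = y.
Proof.
move=> xy; apply/eqP; rewrite -subr_eq0 -(vabs_eq0 vna) eq_le vabs_ge0// andbT.
by apply: (@le0_geometric _ q 1) => // k; rewrite mul1r.
Qed.

(** As [h - id] contracts by [q < 1], its contribution to [h x - h y] is dominated by [x - y], so
    [h] is isometric; [h x = y] is solved by iterating [x |-> y - (h x - x)]. *)
Lemma perturbed_identity_bijective (h : K -> K) :
  (forall x, v x <= 1 -> v (h x - x) <= 1) ->
  (forall x y, v x <= 1 -> v y <= 1 ->
    v (h x - h y - (x - y)) <= q * v (x - y)) ->
  exists h', isometric_bijection v [set x | v x <= 1] h h'.
Proof.
move=> h1 hq.
have hi x y : v x <= 1 -> v y <= 1 -> v (h x - h y) = v (x - y).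
  move=> x1 y1; have [->|xy] := eqVneq x y; first by rewrite !subrr.
  have -> : h x - h y = (x - y) + (h x - h y - (x - y)) by ring.
  apply: vabsD_dominant => //; apply: le_lt_trans (hq _ _ x1 y1) _.
  by rewrite gtr_pMl ?(vabs_p_lt1 pp vp)// vabs_gt0// subr_eq0.
have hO x : v x <= 1 -> v (h x) <= 1.
  by move=> x1; rewrite -[h x](subrK x) vabs_leD ?h1.
have hs y : exists x, v y <= 1 -> v x <= 1 /\ h x = y.
  have [y1|] := boolP (v y <= 1); last by exists 0.
  pose u := fix u n := if n is n'.+1 then y - (h (u n') - u n') else y.
  have uO n : v (u n) <= 1 by elim: n => //= n IH; rewrite vabs_leB ?h1.
  have uS n : v (u n.+1 - u n) <= 1 * q ^+ n.
    rewrite mul1r; elim: n => [|n IH].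
      by rewrite expr0 vabs_leB ?uO.
    have -> : u n.+2 - u n.+1 = - (h (u n.+1) - h (u n) - (u n.+1 - u n)).
      by rewrite /=; ring.
    by rewrite vabsN// exprS (le_trans (hq _ _ (uO _) (uO _)))// ler_wpM2l.
  have [l ul] := geometric_limit vna vc q12 ler01 uS.
  have l1 : v l <= 1.
    by apply: (vabs_le_near vna) (uO 0%N);
      rewrite (le_trans (ul 0%N))// expr0 mulr1.
  exists l => _; split=> //; apply: eq_of_vabs_le => // k.
  have -> : h l - y = (h l - h (u k) - (l - u k)) - (u k.+1 - l).
    by rewrite /=; ring.
  have ulk n : v (u n - l) <= q ^+ n by rewrite (le_trans (ul n)) ?mul1r.
  have qk : 0 <= q ^+ k by exact: exprn_ge0.
  apply: vabs_leB => //; last first.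
    by rewrite (le_trans (ulk _))// exprS ler_piMl.
  rewrite (le_trans (hq _ _ l1 (uO k)))//
    (@le_trans _ _ (q * q ^+ k)) ?ler_piMl//.
  by rewrite ler_wpM2l// vabs_distC.
have [h' h'P] := choice hs.
exists h'; split=> //; split=> [x|y|x x1|y]/=; first exact: hO.
- by move=> /h'P[].
- have [a b] := h'P (h x) (hO x x1).
  by apply/eqP; rewrite -subr_eq0 -(vabs_eq0 vna) -hi// b subrr (vabs0 vna).
- by move=> /h'P[].
Qed.

Section OneMap.
Variable F : K -> K.
Hypothesis ntF : nearly_translation v 1 (q ^+ 4) (q ^+ 4) (q ^+ 4) F.

Let vt1 : v 1 <= 1. Proof. by rewrite vabs1. Qed.
Let qX n : 0 <= q ^+ n. Proof. exact: exprn_ge0. Qed.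
Let qX1 n : q ^+ n <= 1. Proof. exact: exprn_ile1. Qed.
Let FO z : v z <= 1 -> v (F z) <= 1.
Proof. exact: (nearly_translation_disk vna (qX1 4) vt1 ntF). Qed.
Let Fne z z' : v z <= 1 -> v z' <= 1 -> v (F z - F z') <= v (z - z').
Proof. exact: (nearly_translation_nonexpansive vna (qX1 4) ntF). Qed.
Let FnO n z : v z <= 1 -> v (iter n F z) <= 1.
Proof. by move=> z1; elim: n => //= n; exact: FO. Qed.

(** First change [n] at fixed [w]: the surplus iterates act on a point of the disk and
    [iter_nat_displacement] applies. Then change [w] at fixed [n'] by the Lipschitz bound on
    [iter n' F - id]. This uniform continuity extends the iterates to [Z_p]. *)
Lemma iter_near_translation n n' w w' c : v w <= 1 -> v w' <= 1 ->
  v (n%:R - n'%:R) <= c -> v (w - w') <= c ->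
  v ((iter n F w - w - n%:R) - (iter n' F w' - w' - n'%:R)) <= q ^+ 2 * c.
Proof.
move=> w1 w'1 nn ww.
have c0 : 0 <= c by rewrite (le_trans _ ww)// vabs_ge0.
apply: (@vabs_le_trans _ _ _ vna _ _ (iter n' F w - w - n'%:R)).
  wlog n'n : n n' nn / (n' <= n)%N.
    move=> H; have [/H|/ltnW/H] := leqP n' n; first exact.
    by rewrite vabs_distC// => -> //; rewrite vabs_distC.
  rewrite -(subnK n'n) natrD in nn *; rewrite iterD.
  set d := (n - n')%N in nn *; set y := iter n' F w.
  have -> : iter d F y - w - (d%:R + n'%:R) - (y - w - n'%:R) =
    iter d F y - y - d%:R by ring.
  rewrite (le_trans (iter_nat_displacement vna pp vp ntF _ (FnO _ w1)))//.
  by rewrite ler_wpM2l//; move: nn; rewrite addrK.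
have [_ nL _] := nearly_translation_iter vna n' (qX 4) (qX1 4) (qX 4) (qX1 4)
  (qX 4) vt1 ntF.
have -> : iter n' F w - w - n'%:R - (iter n' F w' - w' - n'%:R) =
  iter n' F w - iter n' F w' - (w - w') by ring.
rewrite (le_trans (nL _ _ w1 w'1))//.
by apply: ler_pM => //; [exact: vabs_ge0|exact: ler_wiXn2l].
Qed.

Let pi k x : nat := padic_part p v k x.
(** Truncation at level [k] of [F^(pi x) (x - pi x)], where [pi x] lies in [Z_p]. *)
Let h_ k x : K := iter (pi k x) F (x - (pi k x)%:R).

Let pi_disk k x : v x <= 1 -> v (x - (pi k x)%:R) <= 1.
Proof. by move=> x1; rewrite vabs_leB// vabs_nat_le1. Qed.

Let pi_trans k x y n : v (x - y - n%:R) <= q ^+ k ->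
  v ((pi k x)%:R - (pi k y)%:R - n%:R) <= q ^+ k.
Proof. exact: padic_part_translate. Qed.

Lemma straightening_exists : exists h h' : K -> K,
  isometric_bijection v [set x | v x <= 1] h h' /\
  forall x, v x <= 1 -> h (x + 1) = F (h x).
Proof.
have h_cauchy x k : v x <= 1 -> v (h_ k.+1 x - h_ k x) <= q ^+ 2 * q ^+ k.
  move=> x1; rewrite /h_; set n := pi _ _; set n' := pi _ _.
  have nn : v (n%:R - n'%:R) <= q ^+ k by exact: padic_part_succ.
  have := iter_near_translation (pi_disk k.+1 x1) (pi_disk k x1) nn.
  rewrite -/n -/n'; set a := iter n _ _; set b := iter n' _ _.
  have -> : x - n%:R - (x - n'%:R) = - (n%:R - n'%:R) by ring.
  by rewrite vabsN// => /(_ nn); congr (v _ <= _); ring.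
have [h hP] : exists h : K -> K, forall x, v x <= 1 ->
    forall k, v (h_ k x - h x) <= q ^+ 2 * q ^+ k.
  suff /choice[h hP] : forall x, exists l, v x <= 1 ->
      forall k, v (h_ k x - l) <= q ^+ 2 * q ^+ k by exists h.
  move=> x; have [x1|] := boolP (v x <= 1); last by exists 0.
  have [l lP] := geometric_limit vna vc q12 (qX 2) (h_cauchy x ^~ x1).
  by exists l.
have hO x : v x <= 1 -> v (h x) <= 1.
  move=> x1; apply: (vabs_le_near vna (x := h_ 0 x)); last exact/FnO/pi_disk.
  by rewrite (le_trans (hP _ x1 0%N))// expr0 mulr1.
have [||h' hh'] := @perturbed_identity_bijective h.
- by move=> x x1; rewrite vabs_leB ?hO.
- move=> x y x1 y1; have [->|xy] := eqVneq x y.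
    by rewrite !subrr (vabs0 vna) mulr0.
  have vxy : 0 < v (x - y) by rewrite vabs_gt0// subr_eq0.
  (* The level is matched to [x - y]: the errors [q ^+ 2 * q ^+ k] equal [q * q ^+ k.+1], hence are
     at most [q * v (x - y)]. *)
  have [k /andP[kxy xyk]] : exists k, q ^+ k.+1 < v (x - y) <= q ^+ k.
    have : exists k, q ^+ k < v (x - y).
      apply: contrapT => nk; suff : v (x - y) <= 0 by rewrite leNgt vxy.
      apply: (@le0_geometric _ q 1) => // k.
      by rewrite mul1r leNgt; apply/negP => ?; apply: nk; exists k.
    move=> /ex_minnP[[|k] kP kmin].
      by move: kP; rewrite expr0 ltNge vabs_leB.
    exists k; rewrite kP/= leNgt; apply/negP => /kmin.
    by rewrite ltnn.
  have xy0 : v (x - y - 0%:R) <= q ^+ k by rewrite subr0.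
  have := pi_trans xy0; rewrite subr0 => pxy.
  set n := pi k x in pxy; set n' := pi k y in pxy.
  have ww : v (x - n%:R - (y - n'%:R)) <= q ^+ k.
    have -> : x - n%:R - (y - n'%:R) = (x - y) - (n%:R - n'%:R) by ring.
    exact: vabs_leB.
  have key := iter_near_translation (pi_disk k x1) (pi_disk k y1) pxy ww.
  apply: (@le_trans _ _ (q ^+ 2 * q ^+ k)); last first.
    by rewrite expr2 -mulrA -exprS ler_wpM2l// ltW.
  have -> : h x - h y - (x - y) =
    (h_ k x - (x - n%:R) - n%:R - (h_ k y - (y - n'%:R) - n'%:R)) -
    (h_ k x - h x) + (h_ k y - h y) by ring.
  by apply: vabs_leD => //; [apply: vabs_leB => //|]; exact: hP.
exists h, h'; split=> // x x1; apply: eq_of_vabs_le => // k.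
have x11 : v (x + 1) <= 1 by rewrite vabs_leD ?vabs1.
have hk y : v y <= 1 -> v (h_ k y - h y) <= q ^+ k.
  by move=> y1; rewrite (le_trans (hP _ y1 k))// ler_piMl.
have hkO : v (h_ k x) <= 1 by exact/FnO/pi_disk.
have -> : h (x + 1) - F (h x) =
  (h_ k (x + 1) - F (h_ k x)) - (h_ k (x + 1) - h (x + 1)) + (F (h_ k x) - F (h
    x)).
  by ring.
apply: vabs_leD => //; last by rewrite (le_trans (Fne _ _))// ?hO// hk.
apply: vabs_leB => //; last exact: hk.
have xx : v (x + 1 - x - 1%:R) <= q ^+ k.
  have -> : x + 1 - x - 1%:R = 0 by ring.
  by rewrite (vabs0 vna).
(* Modulo [p ^ k], [pi (x + 1)] is [pi x + 1], and [F (h_ k x)] is [iter n'.+1 F (x - n')]: nearby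
   numbers of iterations from nearby points. *)
have := pi_trans xx.
rewrite /h_ -iterS; set n := pi k (x + 1); set n' := pi k x => nn.
have nn' : v (n%:R - n'.+1%:R) <= q ^+ k by rewrite -addn1 natrD opprD addrA.
have w'1 := pi_disk k x1; rewrite -/n' in w'1.
have w1 := pi_disk k x11; rewrite -/n in w1.
have ww : v (x + 1 - n%:R - (x - n'%:R)) <= q ^+ k.
  by rewrite -vabsN//; move: nn; congr (v _ <= _); ring.
have := iter_near_translation w1 w'1 nn' ww.
set a := iter n _ _; set b := iter n'.+1 _ _ => ab.
have -> : a - b = a - (x + 1 - n%:R) - n%:R - (b - (x - n'%:R) - n'.+1%:R).
  by rewrite -(natr1 n'); ring.
by rewrite (le_trans ab)// ler_piMl.
Qed.

End OneMap.

Lemma nearly_translations_conjugate (F G : K -> K) :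
  nearly_translation v 1 (q ^+ 4) (q ^+ 4) (q ^+ 4) F ->
  nearly_translation v 1 (q ^+ 4) (q ^+ 4) (q ^+ 4) G ->
  exists h h' : K -> K, isometric_bijection v [set x | v x <= 1] h h' /\
    forall x, v x <= 1 -> F (h x) = h (G x).
Proof.
move=> /straightening_exists[f [f' [ff' fF]]] /straightening_exists[g [g' [gg'
  gG]]].
exists (f \o g'), (g \o f'); split.
  exact/isometric_bijection_comp/isometric_bijection_sym.
move=> x x1 /=; have [[gO g'O g'K gK] _] := gg'.
have y1 : v (g' x) <= 1 by exact: g'O.
rewrite -fF// -[in RHS](gK x x1) -gG// g'K//=.
by rewrite vabs_leD ?vabs1.
Qed.

End Straightening.

(** * Difference estimates for power series *)

Section PowerEstimates.
Context (R : realType) (K : fieldType) (v : K -> R).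
Hypothesis vna : nonarch_abs v.

Lemma vabs_subrX_le s k x y : v x <= s -> v y <= s ->
  v (x ^+ k.+1 - y ^+ k.+1) <= s ^+ k * v (x - y).
Proof.
move=> xs ys; have s0 : 0 <= s by rewrite (le_trans _ xs)// vabs_ge0.
elim: k => [|k IH]; first by rewrite expr0 mul1r !expr1.
have -> : x ^+ k.+2 - y ^+ k.+2 =
  x * (x ^+ k.+1 - y ^+ k.+1) + (x - y) * y ^+ k.+1 by rewrite !(exprS _ k.+1);
    ring.
apply: vabs_leD => //; rewrite vabsM//.
  by rewrite [s ^+ _]exprS -mulrA ler_pM ?vabs_ge0.
by rewrite mulrC ler_wpM2r ?vabs_ge0// vabsX// lerXn2r ?nnegrE ?vabs_ge0.
Qed.

Lemma vabs_diff2X_le s k x y u : v x <= s -> v y <= s -> v u <= s ->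
  v ((x + u) ^+ k.+2 - x ^+ k.+2 - (y + u) ^+ k.+2 + y ^+ k.+2) <=
  s ^+ k * (v (x - y) * v u).
Proof.
move=> xs ys us; have s0 : 0 <= s by rewrite (le_trans _ xs)// vabs_ge0.
have xus : v (x + u) <= s by exact: vabs_leD.
have yus : v (y + u) <= s by exact: vabs_leD.
(* A discrete product rule for [X * X ^+ j]; each term of the last group carries one factor from [u]
   and one from [x - y]. *)
have step j : (x + u) ^+ j.+1 - x ^+ j.+1 - (y + u) ^+ j.+1 + y ^+ j.+1 =
    (x + u) * ((x + u) ^+ j - x ^+ j - (y + u) ^+ j + y ^+ j) +
    (u * (x ^+ j - y ^+ j) + (x - y) * ((y + u) ^+ j - y ^+ j)).
  by rewrite !exprS; ring.
elim: k => [|k IH]; rewrite step; apply: vabs_leD => //.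
- rewrite !expr1 [X in v (_ * X)](_ : _ = 0) ?mulr0 ?(vabs0 vna) ?expr0 ?mul1r.
    by rewrite mulr_ge0 ?vabs_ge0.
  by ring.
- have -> : u * (x ^+ 1 - y ^+ 1) + (x - y) * ((y + u) ^+ 1 - y ^+ 1) =
    2%:R * ((x - y) * u) by rewrite !expr1; ring.
  rewrite expr0 mul1r -vabsM// vabsM// ler_piMl ?vabs_ge0//.
  exact: vabs_nat_le1.
- by rewrite vabsM// [s ^+ _]exprS -mulrA ler_pM ?vabs_ge0.
apply: vabs_leD => //; rewrite vabsM//.
  by rewrite mulrA [leRHS]mulrC ler_wpM2l ?vabs_ge0//; exact: vabs_subrX_le.
rewrite mulrCA ler_wpM2l ?vabs_ge0//.
have {2}-> : u = y + u - y by ring.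
exact: vabs_subrX_le.
Qed.

End PowerEstimates.

(** The scale [s] is left free below [r]: around [x0] the bounds are used with [s = v x0] and
    compared with [v (a * x0 ^+ m.+1)]. *)
Definition tangent_estimates (R : realType) (K : fieldType) (v : K -> R)
    (m : nat) (a : K) (f : K -> K) (r B : R) : Prop :=
  forall s : R, s <= r ->
  [/\ forall x, v x <= s -> v (f x - x - a * x ^+ m.+1) <= B * s ^+ m.+2,
      forall x y, v x <= s -> v y <= s ->
        v (f x - f y - (x - y)) <= B * s ^+ m * v (x - y)
    & forall x y u, v x <= s -> v y <= s -> v u <= s ->
        v (f (x + u) - f x - f (y + u) + f y) <= B * s ^+ m.-1 * (v (x - y) * v
          u)].

Section PowerSeries.
Context (R : realType) (K : fieldType) (p : nat) (v : K -> R).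
Hypotheses (vna : nonarch_abs v) (pp : prime p) (vp : v p%:R = p%:R^-1).

(** The terms of a series converging at one point are bounded. Taking a power of [p] as that point
    makes [s] a value of [v]. Terms from index [M] on are at most [1], as differences of partial
    sums close to [f x]; the others are added into [C]. *)
Lemma power_series_coef_bound f c rho : 0 < rho -> power_series_on v f c rho ->
  exists s C, [/\ 0 < s, s < rho & forall k, v (c k) * s ^+ k <= C].
Proof.
move=> rho0 fc; have /andP[q0 q2] := vabs_p_half pp vp.
have [N Nrho] : exists N, v p%:R ^+ N < rho.
  apply: contrapT => nN; suff : rho <= 0 by rewrite leNgt rho0.
  apply: (@le0_geometric _ (v p%:R) 1) => [|k]; first by rewrite q0.
  by rewrite mul1r leNgt; apply/negP => ?; apply: nN; exists k.
set x : K := p%:R ^+ N; have vx : v x = v p%:R ^+ N by rewrite vabsX.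
rewrite -vx in Nrho.
have [M Mx] := vconvergesP vna (fc x Nrho) ltr01.
exists (v x), (1 + \sum_(k < M) v (c k) * v x ^+ k); split=> //.
  by rewrite vx exprn_gt0.
have t0 k : 0 <= v (c k) * v x ^+ k by rewrite mulr_ge0 ?exprn_ge0 ?vabs_ge0.
move=> k; have [kM|Mk] := ltnP k M.
  by rewrite (bigD1 (Ordinal kM))//= addrCA lerDl addr_ge0 ?ler01 ?sumr_ge0.
rewrite -vabsX// -vabsM// (@le_trans _ _ 1)//; last by rewrite lerDl sumr_ge0.
have -> : c k * x ^+ k =
  (\sum_(i < k.+1) c i * x ^+ i - f x) - (\sum_(i < k) c i * x ^+ i - f x).
  by rewrite big_ord_recr/=; ring.
by apply: vabs_leB => //; apply/ltW/Mx => //; exact: leqW.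
Qed.

Lemma vconverges_eq_near (s t : nat -> K) l N :
  (forall n, (N <= n)%N -> s n = t n) -> vconverges v s l -> vconverges v t l.
Proof.
move=> st sl; apply: vconvergesE => // e e0;
  have [N' N's] := vconvergesP vna sl e0.
exists (maxn N N') => n; rewrite geq_max => /andP[Nn N'n].
by rewrite -st//; exact/ltW/N's.
Qed.

Lemma vconverges_cst (l : K) : vconverges v (fun=> l) l.
Proof. by apply: vconvergesE => // e e0; exists 0%N => n _;
  rewrite subrr (vabs0 vna) ltW. Qed.

Lemma tangent_power_series m a f c rho : (1 <= m)%N ->
  power_series_on v f c rho -> tangent_to_id m a c ->
  forall x, v x < rho ->
  vconverges v (fun n => \sum_(m.+1 <= k < n) c k * x ^+ k) (f x - x).
Proof.
move=> m1 fc [c0 c1 cm _] x xr.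
apply: (@vconverges_eq_near (fun n => \sum_(k < n) c k * x ^+ k - x) _ _ m.+1).
  move=> n mn; rewrite -(big_mkord xpredT (fun k => c k * x ^+ k)).
  rewrite (big_cat_nat (n := m.+1))//= (big_cat_nat (n := 2))//=.
  have -> : \sum_(2 <= k < m.+1) c k * x ^+ k = 0.
    by rewrite big_nat_cond big1// => k /andP[/andP[k2 km] _];
      rewrite cm ?mul0r// k2.
  by rewrite big_nat_recl//
    big_nat1 c0 c1 mul0r add0r mul1r expr1 addr0 addrAC subrr add0r.
by apply: vconvergesB => //; [exact: fc|exact: vconverges_cst].
Qed.

Lemma tangent_estimates_exist m a f c rho : (1 <= m)%N -> 0 < rho ->
  power_series_on v f c rho -> tangent_to_id m a c ->
  exists r B, [/\ 0 < r, r < rho, 0 <= B & tangent_estimates v m a f r B].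
Proof.
move=> m1 rho0 fc tc.
have [r [C [r0 rrho rC]]] := power_series_coef_bound rho0 fc.
have C0 : 0 <= C by rewrite (le_trans _ (rC 0%N))//
  mulr_ge0 ?exprn_ge0 ?vabs_ge0 ?ltW.
(* One summand for each lowest degree that occurs: [m.+1] for [f x - x], and [m.+2] once
   [a * x ^+ m.+1] is removed as well. *)
pose B := C / r ^+ m.+1 + C / r ^+ m.+2.
have Bj j : (j == m.+1) || (j == m.+2) -> C / r ^+ j <= B.
  have P k : 0 <= C / r ^+ k by rewrite divr_ge0// exprn_ge0// ltW.
  by case/orP=> /eqP ->; rewrite ?lerDl ?lerDr.
have B0 : 0 <= B by rewrite addr_ge0 ?divr_ge0 ?exprn_ge0// ltW.
exists r, B; split=> //.
have fs := tangent_power_series m1 fc tc.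
(* Here [j] is the lowest degree present and [i] the number of powers of [s] that differencing turns
   into factors [x - y] and [u]. *)
have cb s j i k : 0 <= s -> s <= r -> (j == m.+1) || (j == m.+2) ->
    (i <= j)%N -> (j <= k)%N -> v (c k) * s ^+ (k - i) <= B * s ^+ (j - i).
  move=> s0 sr jm ij jk.
  have -> : (k - i = (k - j) + (j - i))%N by lia.
  rewrite exprD mulrA ler_wpM2r ?exprn_ge0//.
  rewrite (le_trans _ (Bj _ jm))// ler_pdivlMr ?exprn_gt0//.
  rewrite (le_trans _ (rC k))// -mulrA ler_wpM2l ?vabs_ge0//.
  rewrite -[in leRHS](subnK jk) exprD ler_wpM2r ?exprn_ge0 ?(ltW r0)//.
  by apply: lerXn2r => //; rewrite nnegrE// ltW.
move=> s sr; split=> [x xs|x y xs ys|x y u xs ys us].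
- have s0 : 0 <= s by rewrite (le_trans _ xs)// vabs_ge0.
  have xr : v x < rho by rewrite (le_lt_trans xs)// (le_lt_trans sr).
  apply: (@vabs_lim_le _ _ _ vna _ (fun n =>
    \sum_(m.+2 <= k < n) c k * x ^+ k)).
    apply: (@vconverges_eq_near
      (fun n => \sum_(m.+1 <= k < n) c k * x ^+ k - a * x ^+ m.+1) _ _ m.+2).
      move=> n mn; rewrite big_ltn//.
      by case: tc => _ _ _ ->; rewrite addrAC subrr add0r.
    by apply: vconvergesB => //; [exact: fs|exact: vconverges_cst].
  have Bs0 : 0 <= B * s ^+ m.+2 by rewrite mulr_ge0 ?exprn_ge0.
  move=> n; rewrite big_nat_cond;
    apply: vabs_sum_le => // k /andP[/andP[mk _] _].
  rewrite vabsM// (@le_trans _ _ (v (c k) * s ^+ k))//.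
    by rewrite ler_wpM2l ?vabs_ge0// vabsX// lerXn2r ?nnegrE ?vabs_ge0.
  by have := cb s m.+2 0%N k s0 sr; rewrite !subn0; apply; rewrite ?eqxx ?orbT.
- have s0 : 0 <= s by rewrite (le_trans _ xs)// vabs_ge0.
  have sx z : v z <= s -> v z < rho.
    by move=> zs; rewrite (le_lt_trans zs)// (le_lt_trans sr).
  have -> : f x - f y - (x - y) = (f x - x) - (f y - y) by ring.
  apply: (vabs_lim_le vna (vconvergesB vna (fs _ (sx _ xs)) (fs _ (sx _ ys))))
    => n.
  have Bs0 : 0 <= B * s ^+ m * v (x - y).
    exact: mulr_ge0 (mulr_ge0 B0 (exprn_ge0 _ s0)) (vabs_ge0 vna _).
  rewrite -sumrB big_nat_cond;
    apply: vabs_sum_le => // -[|k]// /andP[/andP[mk _] _].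
  rewrite -mulrBr vabsM//.
  apply: (@le_trans _ _ (v (c k.+1) * (s ^+ k * v (x - y)))).
    by rewrite ler_wpM2l ?vabs_ge0//; exact: vabs_subrX_le.
  rewrite mulrA ler_wpM2r ?vabs_ge0//.
  by have := cb s m.+1 1%N k.+1 s0 sr; rewrite !subn1; apply; rewrite ?eqxx.
- have s0 : 0 <= s by rewrite (le_trans _ xs)// vabs_ge0.
  have sx z : v z <= s -> v z < rho.
    by move=> zs; rewrite (le_lt_trans zs)// (le_lt_trans sr).
  have xus : v (x + u) <= s by exact: vabs_leD.
  have yus : v (y + u) <= s by exact: vabs_leD.
  have -> : f (x + u) - f x - f (y + u) + f y =
    ((f (x + u) - (x + u)) - (f x - x)) - ((f (y + u) - (y + u)) - (f y - y))
      by ring.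
  apply: (vabs_lim_le vna (vconvergesB vna
    (vconvergesB vna (fs _ (sx _ xus)) (fs _ (sx _ xs)))
    (vconvergesB vna (fs _ (sx _ yus)) (fs _ (sx _ ys))))) => n.
  have Bs0 : 0 <= B * s ^+ m.-1 * (v (x - y) * v u).
    by rewrite (mulr_ge0 (mulr_ge0 B0 (exprn_ge0 _ s0)))// mulr_ge0 ?vabs_ge0.
  rewrite -!sumrB big_nat_cond; apply: vabs_sum_le => // k /andP[/andP[mk _] _].
  case: k mk => [|[|k]]//; first by case: (m) m1.
  move=> mk; rewrite -!mulrBr vabsM// opprB.
  have -> : (x + u) ^+ k.+2 - x ^+ k.+2 + (y ^+ k.+2 - (y + u) ^+ k.+2) =
    (x + u) ^+ k.+2 - x ^+ k.+2 - (y + u) ^+ k.+2 + y ^+ k.+2 by ring.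
  apply: (@le_trans _ _ (v (c k.+2) * (s ^+ k * (v (x - y) * v u)))).
    by rewrite ler_wpM2l ?vabs_ge0//; exact: vabs_diff2X_le.
  rewrite mulrA ler_wpM2r ?(mulr_ge0 (vabs_ge0 vna _) (vabs_ge0 vna _))//.
  by have := cb s m.+1 2%N k.+2 s0 sr; rewrite !subSS !subn0 subn1; apply;
    rewrite ?eqxx.
Qed.

End PowerSeries.

(** * Isometric conjugacy on a disk *)

Section LocalConjugacy.
Context (R : realType) (K : fieldType) (p : nat) (v : K -> R).
Hypotheses (vna : nonarch_abs v) (vc : vcomplete v) (pp : prime p).
Hypothesis (vp : v p%:R = p%:R^-1).
Let q := v p%:R.

Lemma tangent_estimates0 m a f r B : 0 <= r -> tangent_estimates v m a f r B ->
  f 0 = 0.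
Proof.
move=> r0 /(_ 0 r0)[/(_ 0) f0 _ _]; move: f0;
  rewrite (vabs0 vna) lexx => /(_ isT).
rewrite !subr0 !expr0n/= !mulr0 subr0 => f0.
by apply/eqP; rewrite -(vabs_eq0 vna) eq_le f0 vabs_ge0.
Qed.

Section Rescaling.
Context (m : nat) (a : K) (f : K -> K) (r B : R) (x0 : K).
Hypotheses (m1 : (1 <= m)%N) (a0 : a != 0) (x00 : x0 != 0) (B0 : 0 <= B).
Hypotheses (te : tangent_estimates v m a f r B) (x0r : v x0 <= r) (r1 : r <= 1).
Hypotheses (ar : v a * r <= 1) (Br : B * r <= q ^+ 4) (Bar : B * r <= v a * q
  ^+ 4).

(** With [t = a * x0 ^+ m.+1] and [s = v x0], [v a * r <= 1] gives [v t <= s], so the disk of radius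
    [v t] around [x0] stays at scale [s]. The bound [B * r <= v a * q ^+ 4] makes [f x0 - x0 - t]
    small relative to [t], and [B * r <= q ^+ 4] handles first differences. Rescaling multiplies
    second differences by [t], and [s ^+ m.-1 * v t <= s ^+ m]. *)
Lemma rescaled_nearly_translation :
  nearly_translation v 1 (q ^+ 4) (q ^+ 4) (q ^+ 4)
    (fun z => (f (x0 + a * x0 ^+ m.+1 * z) - x0) / (a * x0 ^+ m.+1)).
Proof.
set t := a * x0 ^+ m.+1; set s := v x0.
have s0 : 0 < s by rewrite vabs_gt0.
have s0' := ltW s0.
have s1 : s <= 1 by rewrite (le_trans x0r).
have t0 : t != 0 by rewrite mulf_neq0// expf_neq0.
have vt : v t = v a * s ^+ m.+1 by rewrite vabsM// vabsX.
have vt0 : 0 < v t by rewrite vabs_gt0.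
have smr : s ^+ m <= r.
  by case: (m) m1 => // k _;
    rewrite exprS (le_trans _ x0r)// ler_piMr// exprn_ile1.
have vts : v t <= s.
  rewrite vt exprSr mulrA ler_piMl//.
  by rewrite (le_trans _ ar)// ler_wpM2l// vabs_ge0.
have Bsm : B * s ^+ m <= q ^+ 4 by rewrite (le_trans _ Br)// ler_wpM2l.
have tz z : v z <= 1 -> v (t * z) <= s.
  by move=> z1; rewrite vabsM// (le_trans _ vts)// ler_piMr// vabs_ge0.
have xz z : v z <= 1 -> v (x0 + t * z) <= s by move=> z1; rewrite vabs_leD// tz.
have [f1 f2 f3] := te x0r.
split=> [z z1|z z' z1 z'1|z z' u z1 z'1 u1].
- have -> : (f (x0 + t * z) - x0) / t - z - 1 =
    ((f (x0 + t * z) - f x0 - (x0 + t * z - x0)) + (f x0 - x0 - t)) / t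
      by field.
  rewrite vabsM// vabsV// ler_pdivrMr//; apply: vabs_leD => //.
    rewrite (le_trans (f2 _ _ (xz _ z1) (lexx _)))//.
    rewrite ler_pM ?(vabs_ge0 vna) ?(mulr_ge0 B0) ?exprn_ge0//.
    by rewrite addrC addKr vabsM// ler_piMr// vabs_ge0.
  rewrite (le_trans (f1 _ (lexx _)))//
    vt exprS mulrA mulrA ler_wpM2r ?exprn_ge0//.
  by rewrite mulrC [_ * v a]mulrC (le_trans _ Bar)// mulrC ler_wpM2l.
- have -> : (f (x0 + t * z) - x0) / t - (f (x0 + t * z') - x0) / t - (z - z') =
    (f (x0 + t * z) - f (x0 + t * z') - (x0 + t * z - (x0 + t * z'))) / t
      by field.
  rewrite vabsM// vabsV// ler_pdivrMr//.
  rewrite (le_trans (f2 _ _ (xz _ z1) (xz _ z'1)))//.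
  have -> : x0 + t * z - (x0 + t * z') = (z - z') * t by ring.
  by rewrite vabsM// -[leRHS]mulrA ler_wpM2r// mulr_ge0// vabs_ge0.
- have -> : (f (x0 + t * (z + u)) - x0) / t - (f (x0 + t * z) - x0) / t -
      (f (x0 + t * (z' + u)) - x0) / t + (f (x0 + t * z') - x0) / t =
    (f (x0 + t * z + t * u) - f (x0 + t * z) - f (x0 + t * z' + t * u) +
     f (x0 + t * z')) / t.
    by rewrite !mulrDr !addrA; field.
  rewrite vabsM// vabsV// ler_pdivrMr//.
  rewrite (le_trans (f3 _ _ _ (xz _ z1) (xz _ z'1) (tz _ u1)))//.
  have -> : x0 + t * z - (x0 + t * z') = t * (z - z') by ring.
  rewrite (vabsM vna t (z - z')) (vabsM vna t u).
  have -> : B * s ^+ m.-1 * (v t * v (z - z') * (v t * v u)) =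
    B * s ^+ m.-1 * v t * (v (z - z') * v u * v t) by ring.
  rewrite -[leRHS]mulrA ler_wpM2r ?(mulr_ge0 (mulr_ge0 _ _))// ?vabs_ge0//.
  rewrite (le_trans _ Bsm)// -mulrA ler_wpM2l//.
  by case: (m) m1 => // k _ /=; rewrite exprSr ler_wpM2l// exprn_ge0.
Qed.

End Rescaling.

(** * Gluing the conjugacies of small disks *)

Section TwoMaps.
Context (m : nat) (a : K) (f g : K -> K) (r B : R).
Hypotheses (m1 : (1 <= m)%N) (a0 : a != 0) (B0 : 0 <= B) (r0 : 0 < r) (r1 : r
  <= 1).
Hypotheses (tf : tangent_estimates v m a f r B) (tg : tangent_estimates v m a g
  r B).
Hypotheses (ar : v a * r < 1) (Br : B * r <= q ^+ 4) (Bar : B * r <= v a * q ^+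
  4).

Lemma local_conjugacy x0 : v x0 <= r -> exists h h',
  isometric_bijection v (closed_disk v x0 (v (a * x0 ^+ m.+1))) h h' /\
  forall x, closed_disk v x0 (v (a * x0 ^+ m.+1)) x -> f (h x) = h (g x).
Proof.
move=> x0r; have [->|x00] := eqVneq x0 0.
  (* At [x0 = 0] the disk is reduced to [0], which both maps fix. *)
  exists id, id; split; first by split=> //; split.
  move=> x; rewrite expr0n/= mulr0 (vabs0 vna) /closed_disk/= subr0 => vx.
  have /eqP -> : x == 0 by rewrite -(vabs_eq0 vna) eq_le vx vabs_ge0.
  by rewrite (tangent_estimates0 (ltW r0) tf) (tangent_estimates0 (ltW r0) tg).
set t := a * x0 ^+ m.+1.
have t0 : t != 0 by rewrite mulf_neq0// expf_neq0.
have vt0 : 0 < v t by rewrite vabs_gt0.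
have [h [h' [[[hO h'O h'K hK] hi] hc]]] :=
  nearly_translations_conjugate vna vc pp vp
  (rescaled_nearly_translation m1 a0 x00 B0 tf x0r r1 (ltW ar) Br Bar)
  (rescaled_nearly_translation m1 a0 x00 B0 tg x0r r1 (ltW ar) Br Bar).
rewrite -/t in hc.
pose up z := x0 + t * z; pose down x := (x - x0) / t.
have upK z : down (up z) = z by rewrite /up /down; field.
have downK x : up (down x) = x by rewrite /up /down; field.
have upB z : v z <= 1 -> closed_disk v x0 (v t) (up z).
  rewrite /closed_disk /up /= addrC addKr => z1.
  by rewrite vabsM// ler_piMr// vabs_ge0.
have downO x : closed_disk v x0 (v t) x -> v (down x) <= 1.
  by rewrite /closed_disk /down /= (vabsM vna (x - x0)) (vabsV vna t)
    ler_pdivrMr// mul1r.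
have upi z z' : v (up z - up z') = v t * v (z - z').
  by rewrite -vabsM//; congr v; rewrite /up; ring.
have downi x x' : v (down x - down x') = v (x - x') / v t.
  by rewrite -vabsV// -vabsM//; congr v; rewrite /down; field.
exists (up \o h \o down), (up \o h' \o down); split; first split; first split.
- by move=> x /downO/hO/upB.
- by move=> x /downO/h'O/upB.
- by move=> x /downO xO /=; rewrite upK h'K// downK.
- by move=> x /downO xO /=; rewrite upK hK// downK.
- move=> x y /downO xO /downO yO /=; rewrite upi hi// downi mulrC divfK//.
  exact: lt0r_neq0.
- move=> x /downO xO /=; rewrite -[f _]downK; congr up.
  have := hc _ xO; rewrite -/(up _) -/(down _) => ->; congr h.
  by rewrite -/(up _) downK.
Qed.

(** Radius of the disk around [x]. On [D] it is less than [v x] for [x != 0] and depends on [v x]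
    alone, so it is constant on the disk; hence the disks partition [D]. *)
Let s x := v (a * x ^+ m.+1).
Let D : set K := closed_disk v 0 r.
Let DE x : D x = (v x <= r) :> Prop. Proof. by rewrite /D /closed_disk/= subr0.
Qed.

Let s_eq x y : v x = v y -> s x = s y.
Proof. by move=> xy; rewrite /s !(vabsM vna) !(vabsX vna) xy. Qed.

Let s_lt x : D x -> x != 0 -> s x < v x.
Proof.
rewrite DE => xr x0; have vx0 : 0 < v x by rewrite vabs_gt0.
rewrite /s vabsM// vabsX// exprS mulrCA gtr_pMr//.
rewrite (le_lt_trans _ ar)// ler_wpM2l ?vabs_ge0//.
case: (m) m1 => // k _; rewrite exprS (le_trans _ xr)// ler_piMr ?(ltW vx0)//.
by rewrite exprn_ile1 ?(ltW vx0)// (le_trans xr).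
Qed.

Let s_le x : D x -> s x <= v x.
Proof.
move=> Dx; have [->|/(s_lt Dx)/ltW//] := eqVneq x 0.
by rewrite /s expr0n/= mulr0.
Qed.

Let near_vabs x y : D x -> v (x - y) <= s x -> v y = v x.
Proof.
move=> Dx; have [->|x0 xy] := eqVneq x 0.
  rewrite /s expr0n/= mulr0 (vabs0 vna) sub0r vabsN// => y0.
  by apply/eqP; rewrite eq_le y0 vabs_ge0.
rewrite -[y](subKr x) vabsD_dominant// vabsN//.
exact: le_lt_trans xy (s_lt Dx x0).
Qed.

Let repr x := xget 0 [set y | v (x - y) <= s x].

Let reprP x : v (x - repr x) <= s x.
Proof.
rewrite /repr; case: xgetP => // /(_ x) []/=.
by rewrite subrr (vabs0 vna) (vabs_ge0 vna).
Qed.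

Let repr_eq x y : D x -> v (x - y) <= s x -> repr x = repr y.
Proof.
move=> Dx xy; rewrite /repr; congr xget.
have <- : s x = s y by apply: s_eq; rewrite (near_vabs Dx xy).
apply/seteqP; split=> z /= h; apply: (vabs_le_trans vna _ h) => //.
by rewrite vabs_distC.
Qed.

Lemma conjugacy_exists : exists h h',
  [/\ isometric_bijection v D h h', h 0 = 0 & forall x, D x ->
    f (h x) = h (g x)].
Proof.
have /choice[H0 H0P] : forall x0, exists hh : (K -> K) * (K -> K), v x0 <= r ->
    isometric_bijection v (closed_disk v x0 (v (a * x0 ^+ m.+1))) hh.1 hh.2 /\
    forall x, closed_disk v x0 (v (a * x0 ^+ m.+1)) x ->
      f (hh.1 x) = hh.1 (g x).
  move=> x0; have [x0r|] := boolP (v x0 <= r); last by exists (id, id).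
  by have [h [h' hh']] := local_conjugacy x0r; exists (h, h').
pose h x := (H0 (repr x)).1 x; pose h' x := (H0 (repr x)).2 x.
have Drepr x : D x -> v (repr x) <= r.
  by move=> Dx; rewrite (near_vabs Dx (reprP x)) -DE.
have inB x : D x -> closed_disk v (repr x) (v (a * repr x ^+ m.+1)) x.
  move=> Dx; rewrite /closed_disk/= -/(s (repr x)).
  by rewrite (s_eq (near_vabs Dx (reprP x))); exact: reprP.
have nearB x y : D x -> closed_disk v (repr x) (v (a * repr x ^+ m.+1)) y ->
    v (x - y) <= s x.
  move=> Dx; rewrite /closed_disk/= -/(s (repr x)).
  rewrite (s_eq (near_vabs Dx (reprP x))) => yx.
  by apply: (vabs_le_trans vna (reprP x)); rewrite vabs_distC.
have hB x : D x -> closed_disk v (repr x) (v (a * repr x ^+ m.+1)) (h x).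
  by move=> Dx; have [[[hB _ _ _] _] _] := H0P _ (Drepr x Dx); exact/hB/inB.
have h'B x : D x -> closed_disk v (repr x) (v (a * repr x ^+ m.+1)) (h' x).
  by move=> Dx; have [[[_ hB' _ _] _] _] := H0P _ (Drepr x Dx); exact/hB'/inB.
have nearD x y : D x -> v (x - y) <= s x -> D y.
  by move=> Dx xy; rewrite DE (near_vabs Dx xy) -DE.
exists h, h'; split; first (split; first split).
- by move=> x Dx; exact: nearD (nearB _ _ Dx (hB x Dx)).
- by move=> x Dx; exact: nearD (nearB _ _ Dx (h'B x Dx)).
- move=> x Dx; rewrite /h' -(repr_eq Dx (nearB _ _ Dx (hB x Dx))).
  by have [[[_ _ hK _] _] _] := H0P _ (Drepr x Dx); exact/hK/inB.
- move=> x Dx; rewrite /h -(repr_eq Dx (nearB _ _ Dx (h'B x Dx))).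
  by have [[[_ _ _ hK] _] _] := H0P _ (Drepr x Dx); exact/hK/inB.
- move=> x y Dx Dy; have [xy|xy] := leP (v (x - y)) (s x).
    have e := repr_eq Dx xy.
    have [[_ hi] _] := H0P _ (Drepr x Dx).
    rewrite {2}/h -e; apply: hi; first exact: inB.
    by rewrite e; exact: inB.
  (* In distinct disks [h] moves each point by at most its own radius, and both radii are below
     [v (x - y)], so the distance is unchanged. *)
  have xy' : s y < v (x - y).
    rewrite ltNge; apply/negP; rewrite vabs_distC// => yx.
    have : s x = s y by exact/s_eq/(near_vabs Dy yx).
    by move: xy; rewrite vabs_distC// => + e; rewrite e ltNge yx.
  have -> : h x - h y = (x - y) + ((h x - x) - (h y - y)) by ring.
  apply: vabsD_dominant => //.
  apply: (@le_lt_trans _ _ (Num.max (s x) (s y))); last by rewrite gt_max xy.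
  have hx := nearB _ _ Dx (hB x Dx); have hy := nearB _ _ Dy (hB y Dy).
  by rewrite vabs_leB// vabs_distC// le_max ?hx ?hy ?orbT.
- have D0 : D 0 by rewrite DE (vabs0 vna) ltW.
  apply/eqP; rewrite -(vabs_eq0 vna) (near_vabs D0 (nearB _ _ D0 (hB 0 D0))).
  by rewrite (vabs0 vna).
(* As [g x] lies in the disk of [x], the same local conjugacy gives [h] at both points. *)
- move=> x Dx; have gx : v (x - g x) <= s x.
    have xr : v x <= r by rewrite -DE.
    have [/(_ x (lexx _)) g1 _ _] := tg xr.
    rewrite vabs_distC//.
    have -> : g x - x = (g x - x - a * x ^+ m.+1) + a * x ^+ m.+1 by ring.
    rewrite vabs_leD// (le_trans g1)// /s vabsM// vabsX// exprS mulrA.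
    rewrite ler_wpM2r ?exprn_ge0 ?vabs_ge0//.
    rewrite (@le_trans _ _ (B * r)) ?ler_wpM2l// (le_trans Bar)//.
    by rewrite ler_piMr ?vabs_ge0// exprn_ile1 ?vabs_ge0 ?vabs_nat_le1.
  rewrite {2}/h -(repr_eq Dx gx).
  by have [_ hc] := H0P _ (Drepr x Dx); exact/hc/inB.
Qed.

Lemma tangent_map_disk : set_fun D D f.
Proof.
move=> x; rewrite !DE => xr; have [/(_ x (lexx _)) f1 _ _] := tf xr.
have Dx : D x by rewrite DE.
have -> : f x = (f x - x - a * x ^+ m.+1) + (a * x ^+ m.+1 + x) by ring.
have sr : s x <= r by rewrite (le_trans (s_le Dx)).
apply: vabs_leD => //; last exact: vabs_leD.
rewrite (le_trans _ sr)// (le_trans f1)// /s vabsM// vabsX// exprS mulrA.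
rewrite ler_wpM2r ?exprn_ge0 ?vabs_ge0//.
rewrite (@le_trans _ _ (B * r)) ?ler_wpM2l// (le_trans Bar)//.
by rewrite ler_piMr ?vabs_ge0// exprn_ile1 ?vabs_ge0 ?vabs_nat_le1.
Qed.

End TwoMaps.
End LocalConjugacy.

(** * Isometries of a disk act on the Berkovich disk *)

Lemma expr_lt_eventually (R : realType) (x e : R) : 0 <= x < 1 -> 0 < e ->
  exists n, x ^+ n < e.
Proof.
move=> /andP[x0 x1] e0; have : `|x| < 1 by rewrite ger0_norm.
move=> /cvg_expr/cvgrPdist_lt/(_ e e0)[n _ /(_ n (leqnn n))].
by rewrite /= sub0r normrN ger0_norm ?exprn_ge0// => ?; exists n.
Qed.

Lemma bernoulli_ge (R : realType) (e : R) n : -1 <= e ->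
  1 + n%:R * e <= (1 + e) ^+ n.
Proof.
move=> e1; elim: n => [|n IH]; first by rewrite mul0r addr0 expr0.
rewrite exprSr (@le_trans _ _ ((1 + n%:R * e) * (1 + e)))//; last first.
  by rewrite ler_wpM2r// -lerBlDl sub0r.
have n0 : 0 <= n%:R :> R by rewrite ler0n.
by rewrite -natr1; nra.
Qed.

(** If [x > y > 0], powers of [x / y = 1 + d] outgrow linear terms. Bernoulli alone is linear, so it
    is applied to half of an even exponent and squared: [n * d ^+ 2 > 2] makes [(1 + n d) ^ 2]
    exceed [2 n + 1]. *)
Lemma le_of_exprn_le_linear (R : realType) (x y : R) : 0 <= y ->
  (forall n, x ^+ n <= n.+1%:R * y ^+ n) -> x <= y.
Proof.
move=> y0 xy; rewrite leNgt; apply/negP => yx.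
have x0 : 0 < x by exact: le_lt_trans yx.
have [y00|y00] := eqVneq y 0.
  by have := xy 1%N; rewrite y00 !expr1 mulr0 leNgt x0.
have {}y0 : 0 < y by rewrite lt_def y00.
pose d := x / y - 1.
have d0 : 0 < d by rewrite subr_gt0 ltr_pdivlMr// mul1r.
have [n nd] : exists n : nat, 2 / d ^+ 2 < n%:R.
  by exists (Num.bound (2 / d ^+ 2));
    rewrite archi_boundP// divr_ge0// exprn_ge0// ltW.
have := xy (n + n)%N; rewrite -ler_pdivrMr ?exprn_gt0// -expr_div_n.
have -> : x / y = 1 + d by rewrite /d; ring.
have B : 1 + n%:R * d <= (1 + d) ^+ n
  by rewrite bernoulli_ge// (le_trans _ (ltW d0))// lerN10.
have n0 : 0 <= n%:R :> R by rewrite ler0n.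
rewrite exprD leNgt => /negP; apply.
apply: (@lt_le_trans _ _ ((1 + n%:R * d) ^+ 2)); last first.
  have nd1 : 0 <= 1 + n%:R * d by rewrite addr_ge0// mulr_ge0// ltW.
  by rewrite expr2 ler_pM.
move: nd; rewrite ltr_pdivrMr ?exprn_gt0// => nd.
have nd' := mulr_ge0 n0 (ltW d0).
rewrite -natr1 natrD.
nra.
Qed.

(** Let [t = 1 - d] approach [1]: by Bernoulli the loss is at most [n * d * x], which the choice of
    [d] keeps below [e]. *)
Lemma le_of_scaled_le (R : realType) (x y : R) n : 0 <= x ->
  (forall t, 0 < t < 1 -> t ^+ n * x <= y) -> x <= y.
Proof.
move=> x0 xy; apply/ler_addgt0Pr => e e0.
pose d := Num.min (2^-1) (e / (n%:R * x + 1)).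
have nx : 0 <= n%:R * x by rewrite mulr_ge0.
have D0 : 0 < n%:R * x + 1 by rewrite ltr_wpDl.
have d0 : 0 < d by rewrite lt_min invr_gt0 ltr0n divr_gt0.
have d2 : d <= 2^-1 by rewrite ge_min lexx.
have de : d * (n%:R * x + 1) <= e by rewrite -ler_pdivlMr// ge_min lexx orbT.
have h2 : (2^-1 : R) < 1 by rewrite invf_lt1// ltr1n.
have t01 : 0 < 1 - d < 1.
  by rewrite subr_gt0 (le_lt_trans d2)//= ltrBlDr ltrDl.
have := xy _ t01.
have B : 1 + n%:R * (- d) <= (1 - d) ^+ n.
  by rewrite bernoulli_ge// lerN2 (le_trans d2)// ltW.
have := ler_wpM2r x0 B; nra.
Qed.

(** * Density of the value group *)

Section ValueGroup.
Context (R : realType) (K : closedFieldType) (p : nat) (v : K -> R).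
Hypotheses (vna : nonarch_abs v) (pp : prime p) (vp : v p%:R = p%:R^-1).

(** For [t > 0] and [n] large, an [n]-th root [z] of [p] has [t / s < v z < 1]. Descending from a
    large value by steps of ratio [v z], the first value below [s] cannot skip past [t]. *)
Lemma vabs_dense (s t : R) : 0 <= t -> t < s -> exists y, t < v y < s.
Proof.
have /andP[q0 q2] := vabs_p_half pp vp; have q1 := vabs_p_lt1 pp vp.
set q := v p%:R in q0 q1 q2.
move=> tge0 ts; wlog t0 : t tge0 ts / 0 < t.
  have s0 := le_lt_trans tge0 ts.
  move=> /(_ (Num.max t (s / 2)))[|||y].
  - by rewrite le_max tge0.
  - by rewrite gt_max ts gtr_pMr// invf_lt1// ltr1n.
  - by rewrite lt_max orbC divr_gt0.
  by rewrite gt_max -andbA => /and3P[ty _ ys]; exists y; rewrite ty.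
have s0 := lt_trans t0 ts.
have [n nq] : exists n, (t / s) ^+ n < q.
  by apply: expr_lt_eventually => //;
    rewrite divr_ge0 ?ltW//= ltr_pdivrMr// mul1r.
have n0 : (0 < n)%N.
  by case: n nq => //; rewrite expr0 => /lt_trans/(_ q1); rewrite ltxx.
have [z zn] := @solve_monicpoly K n (fun i => if i == 0%N then p%:R else 0) n0.
have {}zn : z ^+ n = p%:R.
  rewrite zn; case: (n) n0 => // k _;
    rewrite big_ord_recl/= expr0 mulr1 big1 ?addr0// => i _.
  by rewrite mul0r.
have vz : v z ^+ n = q by rewrite -vabsX// zn.
have vz0 := vabs_ge0 vna z.
have z1 : v z < 1.
  rewrite ltNge; apply/negP => z1.
  by have := exprn_ege1 n z1; rewrite vz leNgt q1.
have tz : t / s < v z.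
  rewrite ltNge; apply/negP => zt.
  have : v z ^+ n <= (t / s) ^+ n.
    by apply: lerXn2r => //; rewrite nnegrE// divr_ge0// ltW.
  by rewrite vz leNgt nq.
have [N Ns] : exists N : nat, s < N%:R.
  by exists (Num.bound s); rewrite archi_boundP// ltW.
have b2 : 2 <= q^-1 by rewrite -[2]invrK lef_pV2 ?posrE ?invr_gt0.
set w : K := p%:R ^- N.
have vw : v w = q^-1 ^+ N by rewrite vabsV// vabsX// exprVn.
have sw : s < v w by rewrite vw (lt_trans Ns)// natr_ltn_expr.
have w0 := lt_trans s0 sw.
have : exists j, v w * v z ^+ j < s.
  have z01 : 0 <= v z < 1 by rewrite vz0.
  have [j] := expr_lt_eventually z01 (divr_gt0 s0 w0).
  by rewrite ltr_pdivlMr// mulrC => ?; exists j.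
move=> /ex_minnP[[|j] js jmin].
  by move: js; rewrite expr0 mulr1 ltNge ltW.
exists (w * z ^+ j.+1); rewrite vabsM// vabsX// js andbT.
have sj : s <= v w * v z ^+ j.
  by rewrite leNgt; apply/negP => /jmin; rewrite ltnn.
rewrite exprSr mulrA (@lt_le_trans _ _ (s * v z))//; last by rewrite ler_wpM2r.
by rewrite mulrC -ltr_pdivrMr.
Qed.

End ValueGroup.

(** * Multiplicative functions determined by linear factors *)

Section LinearFactors.
Context (R : realType) (K : closedFieldType) (v : K -> R).
Hypothesis vna : nonarch_abs v.

Definition poly_roots (P : {poly K}) : seq K :=
  projT1 (closed_field_poly_normal P).

Lemma poly_rootsP P : P = lead_coef P *: \prod_(z <- poly_roots P) ('X - z%:P).
Proof. by rewrite /poly_roots; case: closed_field_poly_normal. Qed.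

(** The only candidate for a multiplicative seminorm that extends [v] and takes the value [phi b] at
    ['X - b%:P], as [K] is algebraically closed. *)
Definition multiplicative_extension (phi : K -> R) (P : {poly K}) : R :=
  v (lead_coef P) * \prod_(z <- poly_roots P) phi z.

Lemma multiplicative_extension_prod phi c s :
  multiplicative_extension phi (c *: \prod_(z <- s) ('X - z%:P)) =
  v c * \prod_(z <- s) phi z.
Proof.
rewrite /multiplicative_extension; set P := c *: _.
have lP : lead_coef P = c.
  by rewrite /P lead_coefZ (monicP _) ?mulr1//; exact: monic_prod_XsubC.
(* For [c = 0] the leading coefficient annihilates whatever roots were chosen; otherwise unique
   factorization makes the two root lists permutations of each other. *)
rewrite lP; have [->|c0] := eqVneq c 0; first by rewrite (vabs0 vna) !mul0r.
congr (_ * _); apply: perm_big; apply: prod_XsubC_eq.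
by have := poly_rootsP P; rewrite lP => /(scalerI c0).
Qed.

Lemma multiplicative_extensionM phi P Q : multiplicative_extension phi (P * Q) =
  multiplicative_extension phi P * multiplicative_extension phi Q.
Proof.
rewrite {1}[P]poly_rootsP {1}[Q]poly_rootsP -scalerAl -scalerAr scalerA.
rewrite -big_cat multiplicative_extension_prod vabsM// big_cat/=.
by rewrite mulrACA.
Qed.

Lemma multiplicative_extensionC phi c : multiplicative_extension phi c%:P = v c.
Proof.
have -> : c%:P = c *: \prod_(z <- [::]) ('X - z%:P).
  by rewrite big_nil -mul_polyC mulr1.
by rewrite multiplicative_extension_prod big_nil mulr1.
Qed.

Lemma multiplicative_extensionX phi b : multiplicative_extension phi ('X -
  b%:P) = phi b.
Proof.
have -> : 'X - b%:P = 1 *: \prod_(z <- [:: b]) ('X - z%:P).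
  by rewrite big_seq1 scale1r.
by rewrite multiplicative_extension_prod big_seq1 vabs1// mul1r.
Qed.

Lemma multiplicative_extension_horner x :
  multiplicative_extension (fun b => v (x - b)) = typeI v x.
Proof.
apply/funext => P; rewrite /typeI {2}[P]poly_rootsP hornerZ horner_prod vabsM//
  vabs_prod//.
by congr (_ * _); apply: eq_bigr => b _; rewrite hornerXsubC.
Qed.

End LinearFactors.

Lemma ptws_continuous (R : realType) (X : eqType) (Y : topologicalType) (f : Y
  -> {ptws X -> R}) :
  (forall x, continuous (fun y => f y x)) -> continuous f.
Proof.
move=> fc y; apply/cvg_sup => i.
(* Evaluation at [i] is onto, by constant functions, so convergence for its initial topology can be
   tested on [R]. *)
apply/cvg_image; first by rewrite eqEsubset; split=> z // _; exists (cst z).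
move=> W /(fc i y) Wf /=; exists (@proj _ (fun=> R) i @^-1` W) => //.
by rewrite eqEsubset; split=> [j [? + <-//]|j Wj]; exists (cst j).
Qed.

Lemma continuous_scaled_prod (R : realType) (T : topologicalType) (I : Type)
    (c : R) (s : seq I) (F : I -> T -> R) : (forall i, continuous (F i)) ->
  continuous (fun x => c * \prod_(i <- s) F i x).
Proof.
move=> Fc x; apply: cvgM; first exact: cvg_cst.
by apply: cvg_big => [|i _]; [exact: mul_continuous|exact: Fc].
Qed.

(** * The extension of an isometry to the Berkovich disk *)

Section BerkovichDisk.
Context (R : realType) (K : closedFieldType) (p : nat) (v : K -> R) (r : R).
Hypotheses (vna : nonarch_abs v) (pp : prime p) (vp : v p%:R = p%:R^-1).
Hypothesis (r0 : 0 <= r).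

Section Seminorm.
Variable N : {poly K} -> R.
Hypothesis BN : berkovich_disk v 0 r N.

Let N_ge0 P : 0 <= N P. Proof. by case: BN => -[]. Qed.
Let N_M P Q : N (P * Q) = N P * N Q. Proof. by case: BN. Qed.
Let N_C c : N c%:P = v c. Proof. by case: BN. Qed.
Let N_X n P : N (P ^+ n) = N P ^+ n.
Proof.
by elim: n => [|n IH]; rewrite ?expr0 ?exprS ?N_M ?IH// -polyC1 N_C (vabs1 vna).
Qed.

(* Subadditivity improves to the ultrametric inequality because [N] is at most
   [1] on the binomial coefficients: expand [(P + Q) ^+ n] and let [n] grow. *)
Lemma berkovich_ultrametric P Q : N (P + Q) <= Num.max (N P) (N Q).
Proof.
set M := Num.max _ _; have M0 : 0 <= M by rewrite le_max N_ge0.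
apply: le_of_exprn_le_linear => // n; rewrite -N_X exprDn.
have N_sum (I : finType) (F : I -> {poly K}) : N (\sum_i F i) <= \sum_i N (F i).
  elim/big_ind2: _ => //; first by rewrite -polyC0 N_C (vabs0 vna).
  move=> x X y Y xX yY; case: BN => -[_ N_D] _ _ _.
  by rewrite (le_trans (N_D _ _))// lerD.
rewrite (le_trans (N_sum _ _))//.
apply: (@le_trans _ _ (\sum_(i < n.+1) M ^+ n));
  last by rewrite sumr_const card_ord mulr_natl.
apply: ler_sum => i _; rewrite -mulr_natl -polyC_natr !N_M N_C !N_X.
have Pm : N P ^+ (n - i) * N Q ^+ i <= M ^+ n.
  rewrite -[in leRHS](@subnK i n) -1?ltnS// exprD.
  by rewrite ler_pM ?exprn_ge0// lerXn2r ?nnegrE// le_max lexx ?orbT.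
rewrite (le_trans _ Pm)// ler_piMl ?mulr_ge0 ?exprn_ge0//.
exact: vabs_nat_le1.
Qed.

(** Reading [N ('X - b%:P)] as the distance from the point [N] to [b], this and the next lemma are
    ultrametric triangle inequalities. *)
Lemma berkovich_linear_le b c : N ('X - b%:P) <= Num.max (N ('X - c%:P)) (v (c
  - b)).
Proof.
have -> : 'X - b%:P = ('X - c%:P) + (c - b)%:P by rewrite polyCB; ring.
by rewrite (le_trans (berkovich_ultrametric _ _))// N_C.
Qed.

Lemma berkovich_vabs_le b c : v (c - b) <= Num.max (N ('X - c%:P)) (N ('X -
  b%:P)).
Proof.
rewrite -N_C; have -> : (c - b)%:P = ('X - b%:P) + (-1)%:P * ('X - c%:P).
  by rewrite polyCB polyCN polyC1; ring.
rewrite (le_trans (berkovich_ultrametric _ _))// N_M N_C vabsN// vabs1// mul1r.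
by rewrite maxC.
Qed.

Let N0 : N ('X - 0%:P) <= r. Proof. by case: BN. Qed.

Lemma berkovich_linear_le_radius b : v b <= r -> N ('X - b%:P) <= r.
Proof.
move=> br; rewrite (le_trans (berkovich_linear_le b 0))// ge_max N0/=.
by rewrite sub0r vabsN.
Qed.

Lemma berkovich_linear_outside b : r < v b -> N ('X - b%:P) = v b.
Proof.
move=> rb; apply/eqP; rewrite eq_le; apply/andP; split.
  rewrite (le_trans (berkovich_linear_le b 0))// ge_max sub0r vabsN//
    lexx andbT.
  by rewrite (le_trans N0)// ltW.
have := berkovich_vabs_le b 0; rewrite sub0r vabsN// le_max => /orP[h|//].
by have := lt_le_trans rb (le_trans h N0); rewrite ltxx.
Qed.

Lemma berkovich_multiplicative_extension :
  N = multiplicative_extension v (fun b => N ('X - b%:P)).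
Proof.
apply/funext => P; rewrite {1}[P]poly_rootsP -mul_polyC N_M N_C; congr (_ * _).
elim: (poly_roots P) => [|z s IH]; first by rewrite !big_nil -polyC1 N_C vabs1.
by rewrite !big_cons N_M IH.
Qed.

(** Let [b0] in [S] be nearest to [N], at distance [s]; the distance to [b] is then the maximum of
    [s] and [v (b0 - b)]. By density some [y] has [v y] below [s] but above [t * s] and above every
    [v (b0 - b)] that is less than [s], and [x = b0 + y] works. *)
Lemma type_I_approximation (S : seq K) (t : R) : 0 < t < 1 ->
  (forall b, b \in S -> v b <= r) ->
  exists x, v x <= r /\
    forall b, b \in S -> t * N ('X - b%:P) <= v (x - b) <= N ('X - b%:P).
Proof.
move=> /andP[t0 t1] Sr; have [->|Sn] := eqVneq S [::].
  by exists 0; rewrite (vabs0 vna).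
have [b0 b0S b0min] : exists2 b0, b0 \in S &
    forall b, b \in S -> N ('X - b0%:P) <= N ('X - b%:P).
  elim: S Sn {Sr} => // a1 S IH _; have [->|/IH[b bS bmin]] := eqVneq S [::].
    by exists a1; rewrite ?mem_head// => b; rewrite inE => /eqP ->.
  have [ab|ba] := leP (N ('X - a1%:P)) (N ('X - b%:P)).
    exists a1; rewrite ?mem_head// => c; rewrite inE => /orP[/eqP ->//|/bmin].
    exact: le_trans.
  exists b; first by rewrite inE bS orbT.
  by move=> c; rewrite inE => /orP[/eqP ->|/bmin//]; exact: ltW.
set s := N ('X - b0%:P) in b0min.
have b0r := Sr _ b0S; have sr : s <= r := berkovich_linear_le_radius b0r.
have tN b : t * N ('X - b%:P) <= N ('X - b%:P) by rewrite ler_piMl// ltW.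
(* If [s = 0], then [b0] itself has the same distances as [N]. *)
have [s0|s0] := eqVneq s 0.
  exists b0; split=> // b bS.
  suff -> : v (b0 - b) = N ('X - b%:P) by rewrite tN lexx.
  apply/eqP; rewrite eq_le; apply/andP; split.
    rewrite (le_trans (berkovich_vabs_le _ _))// ge_max lexx andbT.
    exact: b0min.
  rewrite (le_trans (berkovich_linear_le _ b0))// ge_max lexx andbT -/s s0.
  exact: vabs_ge0.
have {}s0 : 0 < s by rewrite lt_def s0 N_ge0.
have [tau [taus ttau tauS]] : exists tau, [/\ tau < s, t * s <= tau &
    forall b, b \in S -> v (b0 - b) < s -> v (b0 - b) <= tau].
  elim: S {Sn Sr b0S b0min} => [|a1 S [tau [taus ttau tauS]]].
    by exists (t * s); split=> //; rewrite gtr_pMl.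
  have [as_|sa] := ltP (v (b0 - a1)) s.
    exists (Num.max tau (v (b0 - a1))); split.
    - by rewrite gt_max taus.
    - by rewrite le_max ttau.
    - move=> b; rewrite inE le_max => /orP[/eqP -> _|/tauS h /h ->//].
      by rewrite lexx orbT.
  exists tau; split=> // b; rewrite inE => /orP[/eqP ->|/tauS//].
  by rewrite ltNge sa.
have tau0 : 0 <= tau by rewrite (le_trans _ ttau)// mulr_ge0// ltW.
have [y /andP[tauy ys]] := vabs_dense vna pp vp tau0 taus.
exists (b0 + y); split.
  by rewrite vabs_leD// (le_trans (ltW ys)).
move=> b bS; have -> : b0 + y - b = y + (b0 - b) by ring.
have Nb := berkovich_linear_le b b0; rewrite -/s in Nb.
have [ds|sd] := ltP (v (b0 - b)) s.
  rewrite (vabsD_dominant vna); last by rewrite (le_lt_trans _ tauy)// tauS.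
  have -> : N ('X - b%:P) = s.
    by apply/eqP; rewrite eq_le b0min// andbT (le_trans Nb)// ge_max lexx ltW.
  by rewrite (le_trans ttau (ltW tauy)) ltW.
rewrite [y + _]addrC (vabsD_dominant vna) ?(lt_le_trans ys)//.
suff -> : N ('X - b%:P) = v (b0 - b) by rewrite lexx ler_piMl ?vabs_ge0// ltW.
apply/eqP; rewrite eq_le (le_trans Nb) ?ge_max ?sd//=.
have := berkovich_vabs_le b b0; rewrite -/s le_max => /orP[ds|//].
by rewrite (le_trans ds)// b0min.
Qed.

End Seminorm.

Let D : set K := closed_disk v 0 r.
Let DE x : D x = (v x <= r) :> Prop. Proof. by rewrite /D /closed_disk/= subr0.
Qed.

(** Nothing is known of [h'] off the disk; there [v b] is the value that every point of the
    Berkovich disk takes. *)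
Definition pushforward_linear (h' : K -> K) (N : {poly K} -> R) (b : K) : R :=
  if v b <= r then N ('X - (h' b)%:P) else v b.

Definition berkovich_pushforward (h' : K -> K) (N : {ptws {poly K} -> R}) :
    {ptws {poly K} -> R} :=
  multiplicative_extension v (pushforward_linear h' N).

Lemma berkovich_pushforward_disk h h' : isometric_bijection v D h h' ->
  set_fun (berkovich_disk v 0 r) (berkovich_disk v 0 r) (berkovich_pushforward
    h').
Proof.
move=> [[hD h'D h'K hK] hi] N BN; have [[N_ge0 _] _ _ _] := BN.
set phi := pushforward_linear h' N.
have phi0 b : 0 <= phi b by rewrite /phi /pushforward_linear; case: ifP;
  rewrite ?vabs_ge0.
have ext0 P : 0 <= multiplicative_extension v phi P.
  by rewrite mulr_ge0 ?vabs_ge0// prodr_ge0.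
split; last 3 first.
- exact: multiplicative_extensionM.
- exact: multiplicative_extensionC.
- rewrite [berkovich_pushforward _ _ _]multiplicative_extensionX//.
  rewrite /pushforward_linear (vabs0 vna) r0.
  have h'0 : D (h' 0) by apply: h'D; rewrite DE (vabs0 vna).
  by apply: (berkovich_linear_le_radius BN); rewrite -DE.
split=> // P Q; rewrite /berkovich_pushforward -/phi.
set S := poly_roots P ++ poly_roots Q ++ poly_roots (P + Q).
(* One factor [t] is lost per root of [P + Q], where a lower approximation is needed; the upper
   bounds for [P] and [Q] lose nothing. *)
apply: (@le_of_scaled_le _ _ _ (size (poly_roots (P + Q)))) => // t t01.
(* A type I point [x] approximates [N] at the centres [h' b]. Then [h x] approximates the
   pushforward on all linear factors involved, and exactly on those with root off the disk. *)
have [/= b|x [xr xS]] := @type_I_approximation N BN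
    [seq h' b | b <- S & v b <= r] t t01.
  move=> /mapP[c]; rewrite mem_filter => /andP[cr _] ->;
    have Dc : D c by rewrite DE.
  by have := h'D _ Dc; rewrite DE.
have Dx : D x by rewrite DE.
have hxr : v (h x) <= r by rewrite -DE; exact: hD.
have {}xS b : b \in S -> t * phi b <= v (h x - b) <= phi b.
  move=> bS; rewrite /phi /pushforward_linear; case: ifPn => [br|].
    have Db : D b by rewrite DE.
    have -> : v (h x - b) = v (x - h' b) by rewrite -[RHS]hi ?hK//; exact: h'D.
    by apply: xS; apply/mapP; exists b; rewrite // mem_filter br.
  rewrite -ltNge => rb; have -> : v (h x - b) = v b.
    by rewrite vabs_distC// vabsD_dominant// vabsN// (le_lt_trans hxr).
  by have /andP[_ t1] := t01; rewrite lexx andbT ler_piMl ?vabs_ge0// ltW.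
have up U : {subset poly_roots U <= S} ->
    typeI v (h x) U <= multiplicative_extension v phi U.
  move=> US; rewrite -multiplicative_extension_horner//.
  rewrite ler_wpM2l ?vabs_ge0// big_seq [leRHS]big_seq ler_prod// =>
    b /US/xS/andP[_ ->].
  by rewrite vabs_ge0.
have -> : t ^+ size (poly_roots (P + Q)) * multiplicative_extension v phi (P +
  Q) =
    multiplicative_extension v (fun b => t * phi b) (P + Q).
  rewrite mulrCA; congr (_ * _).
  elim: (poly_roots (P + Q)) => [|b s IH]; first by rewrite !big_nil mulr1.
  by rewrite !big_cons -IH exprS; ring.
apply: (@le_trans _ _ (typeI v (h x) (P + Q))).
  rewrite -multiplicative_extension_horner//.
  rewrite ler_wpM2l ?vabs_ge0// big_seq [leRHS]big_seq ler_prod// => b bPQ.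
  have /andP[t0 _] := t01.
  have /xS/andP[-> _] : b \in S by rewrite !mem_cat bPQ !orbT.
  by rewrite mulr_ge0// ltW.
apply: (@le_trans _ _ (typeI v (h x) P + typeI v (h x) Q)).
  have [[_ H] _ _ _] := typeI_berkovich_disk (a := h x) (r := 0) (x := h x) vna
    (eq_ind_r (fun y => v y <= 0) (eq_ind_r (fun y =>
      y <= 0) (lexx 0) (vabs0 vna)) (subrr _)).
  exact: H.
by rewrite lerD// up// => b bU; rewrite !mem_cat bU ?orbT.
Qed.

Lemma berkovich_pushforwardK h h' : isometric_bijection v D h h' ->
  forall N, berkovich_disk v 0 r N ->
  berkovich_pushforward h (berkovich_pushforward h' N) = N.
Proof.
move=> [[hD h'D h'K hK] hi] N BN; rewrite {1}/berkovich_pushforward.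
rewrite [RHS](berkovich_multiplicative_extension BN);
  congr multiplicative_extension.
apply/funext => b; rewrite {1}/pushforward_linear; case: ifPn => [br|].
  have Db : D b by rewrite DE.
  rewrite /berkovich_pushforward multiplicative_extensionX//.
  have hbr : v (h b) <= r by rewrite -DE; exact: hD.
  by rewrite /pushforward_linear hbr h'K.
by rewrite -ltNge => rb; rewrite (berkovich_linear_outside BN).
Qed.

Lemma berkovich_pushforward_typeI h h' : isometric_bijection v D h h' ->
  forall x, D x -> berkovich_pushforward h' (typeI v x) = typeI v (h x).
Proof.
move=> [[hD h'D h'K hK] hi] x Dx.
rewrite -[RHS]multiplicative_extension_horner//; congr multiplicative_extension.
apply/funext => b; rewrite /pushforward_linear; case: ifPn => [br|].
  have Db : D b by rewrite DE.
  by rewrite /typeI hornerXsubC -[LHS]hi ?hK//; exact: h'D.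
rewrite -ltNge => rb; rewrite vabs_distC// vabsD_dominant// vabsN//.
by rewrite (le_lt_trans _ rb)// -DE; exact: hD.
Qed.

(** Each value of the pushforward is a constant times a finite product of values of [N] and
    constants. *)
Lemma berkovich_pushforward_continuous h' : continuous (berkovich_pushforward
  h').
Proof.
apply: ptws_continuous => P; apply: continuous_scaled_prod => b.
rewrite /pushforward_linear; case: (v b <= r); last exact: cst_continuous.
exact: (@proj_continuous _ (fun=> R)).
Qed.

Lemma isometric_bijection_extends h h' : isometric_bijection v D h h' ->
  exists H : {ptws {poly K} -> R} -> {ptws {poly K} -> R},
    homeomorphism (berkovich_disk v 0 r) (berkovich_disk v 0 r) H /\
    forall x, D x -> H (typeI v x) = typeI v (h x).
Proof.
move=> hh'; have h'h := isometric_bijection_sym hh'.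
exists (berkovich_pushforward h'); split;
  last exact: berkovich_pushforward_typeI.
exists (berkovich_pushforward h); split.
- split; [exact: berkovich_pushforward_disk hh'|exact:
  berkovich_pushforward_disk h'h| |].
    exact: berkovich_pushforwardK.
  exact: berkovich_pushforwardK.
- exact/continuous_subspaceT/berkovich_pushforward_continuous.
- exact/continuous_subspaceT/berkovich_pushforward_continuous.
Qed.

End BerkovichDisk.

(** * A common radius for both maps, and the conclusion *)

Lemma tangent_estimates_weaken (R : realType) (K : fieldType) (v : K -> R)
    (m : nat) (a : K) (f : K -> K) (r B r' B' : R) : nonarch_abs v ->
  r' <= r -> B <= B' -> tangent_estimates v m a f r B ->
  tangent_estimates v m a f r' B'.
Proof.
move=> vna rr BB te s sr'; have [f1 f2 f3] := te s (le_trans sr' rr).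
have Bs x n : v x <= s -> B * s ^+ n <= B' * s ^+ n.
  move=> xs; rewrite ler_wpM2r// exprn_ge0// (le_trans _ xs)//.
  exact: (vabs_ge0 vna).
split=> [x xs|x y xs ys|x y u xs ys us].
- exact: le_trans (f1 _ xs) (Bs _ _ xs).
- by rewrite (le_trans (f2 _ _ xs ys))// ler_wpM2r ?(vabs_ge0 vna)//
  (Bs _ _ xs).
- rewrite (le_trans (f3 _ _ _ xs ys us))// ler_wpM2r ?(Bs _ _ xs)//.
  by rewrite mulr_ge0 ?(vabs_ge0 vna).
Qed.

Theorem corollary5p13 (R : realType) (K : closedFieldType) (p : nat)
    (v : K -> R) (m : nat) (a : K) (f g : K -> K) (cf cg : nat -> K)
    (rhof rhog : R) :
  prime p -> padic_field p v ->
  (1 <= m)%N -> a != 0 ->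
  0 < rhof -> power_series_on v f cf rhof -> tangent_to_id m a cf ->
  0 < rhog -> power_series_on v g cg rhog -> tangent_to_id m a cg ->
  exists r : R,
    [/\ 0 < r, r < rhof, r < rhog,
        set_fun (closed_disk v 0 r) (closed_disk v 0 r) f
      & set_fun (closed_disk v 0 r) (closed_disk v 0 r) g] /\
    exists h h' : K -> K,
      [/\ lipeomorphism v (closed_disk v 0 r) h h',
          h 0 = 0,
          forall x : K, closed_disk v 0 r x -> h' (f (h x)) = g x
        & exists H : {ptws {poly K} -> R} -> {ptws {poly K} -> R},
            homeomorphism (berkovich_disk v 0 r) (berkovich_disk v 0 r) H /\
            forall x : K, closed_disk v 0 r x -> H (typeI v x) = typeI v (h x)].
Proof.
move=> pp [vna vc _ vp] m1 a0 rhof0 fc tf rhog0 gc tg.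
have [rf [Bf [rf0 rfr Bf0 ef]]] :=
  tangent_estimates_exist vna pp vp m1 rhof0 fc tf.
have [rg [Bg [rg0 rgr Bg0 eg]]] :=
  tangent_estimates_exist vna pp vp m1 rhog0 gc tg.
have /andP[q0 _] := vabs_p_half pp vp.
have va0 : 0 < v a by rewrite vabs_gt0.
set q := v p%:R in q0; pose B := Bf + Bg.
have B0 : 0 <= B by rewrite addr_ge0.
have small (c d : R) : 0 <= c -> 0 < d -> \forall r \near 0^'+, c * r < d.
  move=> c0 d0; have c1 : 0 < c + 1 by rewrite ltr_wpDl.
  near=> r; have r0 : 0 < r by [].
  rewrite (@le_lt_trans _ _ ((c + 1) * r)) ?ler_wpM2r ?(ltW r0) ?lerDl//.
  rewrite mulrC -ltr_pdivlMr//; near: r.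
  by apply: nbhs_right_lt; rewrite divr_gt0.
have q4 : 0 < q ^+ 4 by rewrite exprn_gt0.
(* These are the smallness conditions of the gluing for both maps at once; being finitely many, they
   hold for all small [r > 0]. *)
have [r [r0 [rrf rrg r1] [ar Br Bar]]] : exists r : R, [/\ 0 < r,
    [/\ r <= rf, r <= rg & r <= 1] &
    [/\ v a * r < 1, B * r <= q ^+ 4 & B * r <= v a * q ^+ 4]].
  near (0 : R)^'+ => r; exists r; split=> //; split; near: r.
  - exact: nbhs_right_le.
  - exact: nbhs_right_le.
  - exact: nbhs_right_le.
  - by apply: small => //; exact: ltW.
  - by apply: filterS (small _ _ B0 q4) => r; exact: ltW.
  - by apply: filterS (small _ _ B0 (mulr_gt0 va0 q4)) => r; exact: ltW.
have {}ef : tangent_estimates v m a f r B.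
  by apply: tangent_estimates_weaken ef => //; rewrite lerDl.
have {}eg : tangent_estimates v m a g r B.
  by apply: tangent_estimates_weaken eg => //; rewrite lerDr.
exists r; split.
  split=> //.
  - exact: le_lt_trans rfr.
  - exact: le_lt_trans rgr.
  - exact: (tangent_map_disk vna m1 B0 r1 ef ar Bar).
  - exact: (tangent_map_disk vna m1 B0 r1 eg ar Bar).
have [h [h' [hh' h0 hc]]] :=
  conjugacy_exists vna vc pp vp m1 a0 B0 r0 r1 ef eg ar Br Bar.
have [[hD h'D h'K hK] hi] := hh'; have [_ h'i] := isometric_bijection_sym hh'.
have D0 : closed_disk v 0 r 0 by rewrite /closed_disk/= subr0 (vabs0 vna) ltW.
exists h, h'; split.
- split; first by split.
    by exists 1 => x y Dx Dy; rewrite mul1r hi.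
  by exists 1 => x y Dx Dy; rewrite mul1r h'i.
- exact: h0.
- move=> x Dx; rewrite hc// h'K//.
  exact: (tangent_map_disk vna m1 B0 r1 eg ar Bar).
- exact: (isometric_bijection_extends vna pp vp (ltW r0) hh').
Unshelve. all: by end_near. Qed.
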